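(* Suppose $\Gamma$ is a countable sofic group with sofic approximation $\Sigma$, that $\Gamma$ acts by homeomorphisms on compact metric spaces $X$ and $Y$, and that $\pi: X\to Y$ is a topologically prime extension. Then $$h_\Gamma^\Sigma(X) \le h_\Gamma^\Sigma(Y).$$ In particular, topologically prime actions of countable sofic groups (on compact metric spaces) have non-positive topological sofic entropy.
   Context: A topological factor map $\pi: X\to Y$ between actions of $\Gamma$ is a continuous surjective $\Gamma$-equivariant map. It is a topologically prime extension if the action on $X$ has no (strictly) intermediate factors; equivalently, there is no $\Gamma$-invariant $C^*$-subalgebra $A$ of $C(X)$ (continuous complex-valued functions) with $\pi_*(C(Y)) \subsetneq A \subsetneq C(X)$, where $\pi_*(h)=h\circ\pi$. An action of $\Gamma$ on $X$ is topologically prime if every factor map from it is either an isomorphism or maps onto the trivial action on the one-point space. A sofic approximation of $\Gamma$ is a sequence $\Sigma = (\sigma_i:\Gamma\to \mathrm{Sym}(d_i))_{i\ge 1}$ of maps, with $d_i\to\infty$, such that for all $s,t\in\Gamma$, $\frac{1}{d_i}|\{v\in\{1,\dots,d_i\}: \sigma_i(st)v=\sigma_i(s)\sigma_i(t)v\}|\to 1$, and for all $s\ne t$, $\frac1{d_i}|\{v: \sigma_i(s)v\neq\sigma_i(t)v\}|\to 1$; $\Gamma$ is sofic if it has one. The topological sofic entropy $h^\Sigma_\Gamma(X)\in\{-\infty\}\cup[0,\infty]$ is the one of Kerr and Li: fix a compatible metric $\rho$ on $X$; for finite $F\subset\Gamma$, $\delta>0$ and $\sigma:\Gamma\to\mathrm{Sym}(d)$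 let $\mathrm{Map}(\rho,F,\delta,\sigma)$ be the set of maps $\varphi:\{1,\dots,d\}\to X$ with $\left(\frac1d\sum_{v=1}^d \rho(\varphi(\sigma(s)v), s\varphi(v))^2\right)^{1/2}\le\delta$ for all $s\in F$; let $N_\varepsilon(\cdot)$ be the maximal cardinality of an $\varepsilon$-separated subset for the metric $\max_v\rho(\varphi(v),\psi(v))$. Then $$h_\Gamma^\Sigma(X) = \sup_{\varepsilon>0}\ \inf_{F}\ \inf_{\delta>0}\ \limsup_{i\to\infty}\frac{1}{d_i}\log N_\varepsilon(\mathrm{Map}(\rho,F,\delta,\sigma_i)),$$ where $F$ ranges over finite subsets of $\Gamma$ and $\log 0=-\infty$; this does not depend on $\rho$.
   Formalization: The group Γ is assumed countably infinite: for finite Γ the claim fails, e.g. Γ trivial, X two points and Y one point is a topologically prime extension with entropy log 2 for X and 0 for Y. *)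

(* Defs.v *)
From HB Require Import structures.
From mathcomp Require Import all_boot all_order all_algebra all_fingroup.
From mathcomp Require Import all_classical all_reals all_analysis.

Set Implicit Arguments.
Unset Strict Implicit.
Unset Printing Implicit Defensive.

Import Order.TTheory GRing.Theory Num.Theory.
Import numFieldNormedType.Exports.

Local Open Scope classical_set_scope.
Local Open Scope ring_scope.

(* Invertibility of each [a s] with continuous inverse [a s^-1] follows from the
   action laws, so this is an action by homeomorphisms. *)
Definition continuous_action (G : groupType) (X : topologicalType)
    (a : G -> X -> X) : Prop :=
  [/\ forall x, a 1%g x = x,
      forall s t x, a (s * t)%g x = a s (a t x)
    & forall s, continuous (a s)].

Definition factor_map (G : groupType) (X Y : topologicalType)
    (a : G -> X -> X) (b : G -> Y -> Y) (f : X -> Y) : Prop :=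
  [/\ continuous f,
      forall y, exists x, f x = y
    & forall s x, f (a s x) = b s (f x)].

Definition factor_isomorphism (G : groupType) (X Y : topologicalType)
    (a : G -> X -> X) (b : G -> Y -> Y) (f : X -> Y) : Prop :=
  factor_map a b f /\
  exists g : Y -> X, [/\ cancel f g, cancel g f & continuous g].

(* Intermediate factors range over compact Hausdorff spaces, as do the spectra
   of the invariant C*-subalgebras of C(X); when X is compact metric, every such
   factor is metrizable. *)
Definition topologically_prime_extension (G : groupType) (X Y : topologicalType)
    (a : G -> X -> X) (b : G -> Y -> Y) (p : X -> Y) : Prop :=
  factor_map a b p /\
  forall (Z : topologicalType) (c : G -> Z -> Z) (f : X -> Z) (g : Z -> Y),
    compact [set: Z] -> hausdorff_space Z -> continuous_action c ->
    factor_map a c f -> factor_map c b g -> (forall x, g (f x) = p x) ->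
    factor_isomorphism a c f \/ factor_isomorphism c b g.

Definition topologically_prime (G : groupType) (X : topologicalType)
    (a : G -> X -> X) : Prop :=
  forall (Z : topologicalType) (c : G -> Z -> Z) (f : X -> Z),
    compact [set: Z] -> hausdorff_space Z -> continuous_action c ->
    factor_map a c f ->
    factor_isomorphism a c f \/ exists z0 : Z, forall z, z = z0.

(* Products of permutations in [{perm T}] compose from left to right, so
   sigma(s)sigma(t) is written pointwise. *)
Definition sofic_approximation (R : realType) (G : groupType) (d : nat -> nat)
    (sigma : forall i, G -> {perm 'I_(d i)}) : Prop :=
  [/\ d @ \oo --> \oo,
      forall s t : G,
        (#|[set v | sigma i (s * t)%g v == sigma i s (sigma i t v)]%SET|%:R
           / (d i)%:R : R) @[i --> \oo] --> (1 : R)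
    & forall s t : G, s <> t ->
        (#|[set v | sigma i s v != sigma i t v]%SET|%:R
           / (d i)%:R : R) @[i --> \oo] --> (1 : R)].

Section sofic_entropy.
Variables (R : realType) (G : groupType) (X : metricType R).
Implicit Types (a : G -> X -> X) (d : nat).

Definition Map a (F : set G) (delta : R) d (s : G -> {perm 'I_d}) :
    set ('I_d -> X) :=
  [set phi | forall g, F g ->
    Num.sqrt (d%:R^-1 * \sum_(v < d) mdist (phi (s g v)) (a g (phi v)) ^+ 2)
      <= delta].

Definition max_dist d (phi psi : 'I_d -> X) : R :=
  \big[Num.max/0]_(v < d) mdist (phi v) (psi v).

Definition separated d (eps : R) (E : set ('I_d -> X)) : Prop :=
  forall phi psi, E phi -> E psi -> phi <> psi -> eps <= max_dist phi psi.

(* The maximal cardinality of a finite separated subset, as a supremum; it is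
   attained when X is compact, and is 0 when A is empty. *)
Definition sep_number d (eps : R) (A : set ('I_d -> X)) : \bar R :=
  ereal_sup [set n%:R%:E | n in
    [set n : nat | exists E : set ('I_d -> X),
       [/\ E `<=` A, (E #= `I_n)%card & separated eps E]]].

(* [lne 0 = -oo]. *)
Definition sofic_entropy a (d : nat -> nat)
    (sigma : forall i, G -> {perm 'I_(d i)}) : \bar R :=
  ereal_sup [set
    ereal_inf [set
      ereal_inf [set
        limn_esup (fun i => ((d i)%:R^-1)%:E
                     * lne (sep_number eps (Map a F delta (sigma i))))%E
      | delta in [set delta : R | 0 < delta]]
    | F in [set F : set G | finite_set F]]
  | eps in [set eps : R | 0 < eps]].

End sofic_entropy.

(* Main.v *)
From HB Require Import structures.
Require Import Defs.
From mathcomp Require Import all_boot all_order all_algebra all_fingroup.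
From mathcomp Require Import all_classical all_reals all_analysis.
From mathcomp Require Import ring lra zify.

(* Suppose h(Y) < h(X) and fix large separated families of almost equivariant
   maps phi : {1..d} -> X, exponentially more numerous than their images p o phi
   are at any fixed scale.  Let D be the set of points x with p x = p x'
   for some x' <> x.

   If D is finite, two maps with close images can only differ where both are
   near the finite invariant set D, and the point of D near phi(v) determines
   the one near phi(sigma(s) v).  As G is infinite, a set of d/r vertices
   dominates almost all the others, so the maps with close images are
   subexponentially few.

   If D is infinite, we build a continuous h : X -> [0, 1], not factoring
   through p, such that h o phi has small entropy on a subfamily of full
   exponential size.  Start with a bump around one of many points of D, chosen
   so that most phi rarely visit its support.  Then compose repeatedly with
   staircase functions, tending to the identity, whose rises are rarely visited
   by most of the remaining phi: this is a pigeonhole among disjoint sets of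
   rises, so it costs no entropy.  In the limit, h takes a number n_j of values
   off a set visited at rate 1/M_j, where M_j may be chosen after n_j.  By
   primeness p and the translates of h separate points, so the images p o phi
   and h o phi together determine phi up to the separation scale, a
   contradiction. *)

Set Implicit Arguments.
Unset Strict Implicit.
Unset Printing Implicit Defensive.

Import Order.TTheory GRing.Theory Num.Theory.
Import numFieldNormedType.Exports.

Local Open Scope classical_set_scope.
Local Open Scope ring_scope.

(** * Counting *)

Lemma sparse_count (R : realType) (T : finType) (kappa : R) : 0 < kappa ->
  exists m0 : nat, forall m d : nat, (m0 <= m)%N ->
    #|[set c : {ffun 'I_d -> option T} |
        (#|[set v | c v != None]%SET| * m <= d)%N]%SET|%:R
      <= expR (kappa * d%:R) :> R.
Proof.
(* Give weight [expR (- b)] to the values [Some _] and [1] to [None]: the total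
   weight of all functions is small, that of a sparse one is not. *)
move=> k0; set q : R := #|T|%:R.
have q0 : 0 <= q by rewrite ler0n.
(* With this [b], the inequality [1 + b <= expR b] gives [q * expR (- b) <= kappa / 2]. *)
pose b : R := 2 * q / kappa.
have b0 : 0 <= b by rewrite divr_ge0 ?mulr_ge0 // ltW.
have qb : q * expR (- b) <= kappa / 2.
  rewrite expRN ler_pdivrMr ?expR_gt0//.
  apply: (@le_trans _ _ (kappa / 2 * (1 + b))).
    rewrite /b; have -> : kappa / 2 * (1 + 2 * q / kappa) = kappa / 2 + q.
      by field; rewrite gt_eqF.
    lra.
  by rewrite ler_wpM2l ?divr_ge0 ?(ltW k0)// expR_ge1Dx.
pose m0 := (Num.truncn (2 * b / kappa)).+1.
exists m0 => m d m0m.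
have bm : b <= kappa / 2 * m%:R.
  have : 2 * b / kappa <= m%:R.
    by apply/ltW/(lt_le_trans (truncnS_gt _)); rewrite ler_nat.
  by rewrite ler_pdivrMr// => h; lra.
pose w (o : option T) : R := if o is Some _ then expR (- b) else 1.
have w0 o : 0 <= w o by case: o => [?|] //=; exact: expR_ge0.
have tot : \sum_(c : {ffun 'I_d -> option T}) \prod_v w (c v)
    <= expR (kappa / 2 * d%:R).
  rewrite -(bigA_distr_bigA (fun=> w)) prodr_const card_ord.
  have -> : \sum_o w o = 1 + q * expR (- b).
    rewrite (bigD1 None)//=; congr (_ + _).
    rewrite (reindex_omap Some id)/=; last by case.
    under eq_bigl => i do rewrite eqxx.
    by rewrite sumr_const -mulr_natl.
  rewrite expRM_natr; apply: lerXn2r.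
  - by rewrite nnegrE addr_ge0 ?mulr_ge0 ?expR_ge0.
  - by rewrite nnegrE expR_ge0.
  - by apply: (le_trans (expR_ge1Dx _)); rewrite ler_expR.
set A := [set c | _]%SET.
have lowA c : c \in A -> expR (- (kappa / 2 * d%:R)) <= \prod_v w (c v).
  rewrite inE => cA.
  have -> : \prod_v w (c v) = expR (- (b * #|[set v | c v != None]%SET|%:R)).
    rewrite (bigID (fun v => c v != None))/= [X in _ * X]big1 ?mulr1; last first.
      by move=> v; rewrite negbK => /eqP ->.
    transitivity (\prod_(v in [set v | c v != None]%SET) expR (- b)).
      by apply: eq_big => v; [rewrite inE | case: (c v)].
    by rewrite prodr_const -expRM_natr; congr expR; ring.
  rewrite ler_expR lerN2.
  apply: (@le_trans _ _ (kappa / 2 * m%:R * #|[set v | c v != None]%SET|%:R)).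
    by rewrite ler_wpM2r.
  rewrite -mulrA ler_wpM2l ?divr_ge0 ?(ltW k0)// -natrM ler_nat mulnC.
  exact: cA.
have : #|A|%:R * expR (- (kappa / 2 * d%:R)) <= expR (kappa / 2 * d%:R).
  apply: le_trans tot.
  rewrite (bigID (mem A))/= -[leLHS]addr0; apply: lerD; last first.
    by apply: sumr_ge0 => c _; apply: prodr_ge0.
  rewrite mulr_natl -sumr_const; apply: ler_sum => c cA; exact: lowA.
rewrite expRN ler_pdivrMr ?expR_gt0// -expRD.
by congr (_ <= expR _); lra.
Qed.

(** An entropy bound in the form of a code with at most [B] words on [S]. As [P] need not be
    transitive, closeness at a fixed scale can be coded as well, and conjunctions only multiply the
    bounds. *)
Definition coded (R : realType) (I : finType) (S : {set I}) (B : R)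
    (P : I -> I -> Prop) : Prop :=
  exists (T : finType) (e : I -> T), #|e @: S|%:R <= B /\
    forall i j, i \in S -> j \in S -> e i = e j -> P i j.

Section coded.
Variables (R : realType) (I : finType).
Implicit Types (S : {set I}) (B : R) (P Q : I -> I -> Prop).

Lemma coded_and S B C P Q : coded S B P -> coded S C Q ->
  coded S (B * C) (fun i j => P i j /\ Q i j).
Proof.
move=> [T [e [eB eP]]] [U [f [fC fQ]]].
exists (T * U)%type, (fun i => (e i, f i)); split; last first.
  by move=> i j iS jS [/(eP _ _ iS jS) ? /(fQ _ _ iS jS)].
apply: (@le_trans _ _ (#|e @: S| * #|f @: S|)%:R); last first.
  by rewrite natrM ler_pM.
rewrite ler_nat -cardsX; apply/subset_leq_card/fintype.subsetP => _ /imsetP[i iS ->].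
by rewrite inE/= !imset_f.
Qed.

Lemma coded_sub S B C P Q : B <= C ->
  (forall i j, i \in S -> j \in S -> P i j -> Q i j) ->
  coded S B P -> coded S C Q.
Proof.
move=> BC PQ [T [e [eB eP]]]; exists T, e; split; first exact: le_trans BC.
by move=> i j iS jS /(eP _ _ iS jS) /PQ; apply.
Qed.

Lemma coded_subset S S' B P : S' \subset S -> coded S B P -> coded S' B P.
Proof.
move=> /fintype.subsetP S'S [T [e [eB eP]]]; exists T, e; split.
  apply: le_trans eB; rewrite ler_nat; apply: subset_leq_card.
  by apply: imsetS; apply/fintype.subsetP.
by move=> i j /S'S iS /S'S jS; exact: eP.
Qed.

Lemma coded_card S B : coded S B (fun i j => i = j) -> #|S|%:R <= B.
Proof.
move=> [T [e [eB eP]]]; rewrite -(@card_in_imset _ _ e)// => i j iS jS.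
Qed.

End coded.

(** The functions [c i] are their own code words, counted by [sparse_count]. The threshold [m0]
    depends only on [T] and [kappa], so a visit rate can be fixed as soon as the alphabet is
    known. *)
Lemma coded_sparse (R : realType) (T : finType) (kappa : R) : 0 < kappa ->
  exists m0 : nat, forall (I : finType) (m d : nat) (S : {set I})
      (c : I -> 'I_d -> option T),
    (m0 <= m)%N ->
    (forall i, i \in S -> (#|[set v | c i v != None]%SET| * m <= d)%N) ->
    coded S (expR (kappa * d%:R)) (fun i j => forall v, c i v = c j v).
Proof.
move=> k0; have [m0 H] := sparse_count T k0.
exists m0 => I m d S c mm cS.
exists {ffun 'I_d -> option T}, (fun i => [ffun v => c i v]); split.
  apply: le_trans (H m d mm); rewrite ler_nat; apply: subset_leq_card.
  apply/fintype.subsetP => _ /imsetP[i iS ->]; rewrite inE.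
  apply: leq_trans (cS i iS); rewrite leq_mul2r; apply/orP; right.
  by apply: subset_leq_card; apply/fintype.subsetP => v; rewrite !inE ffunE.
by move=> i j _ _ /ffunP eij v; have := eij v; rewrite !ffunE.
Qed.

Lemma leq_card_bigcup (I V : finType) (A : I -> {set V}) :
  (#|\bigcup_i A i|%SET <= \sum_i #|A i|)%N.
Proof.
elim/big_rec2 : _ => [|i n C _ CN]; first by rewrite cards0.
by apply: (leq_trans (leq_card_setU _ _)); rewrite leq_add2l.
Qed.

(* Exponential size at rate [L], for infinitely many [k]; the loss [1 / (K + 1)]
   makes this property survive finite partitions, see [large_split]. *)
Definition large (R : realType) (L : R) (d : nat -> nat) (I : nat -> finType)
    (A : forall k, {set I k}) : Prop :=
  forall K, exists k, (K <= k)%N /\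
    expR ((L - K.+1%:R^-1) * (d k)%:R) <= #|A k|%:R.

(** If no part were large, each would stay below its bound from some [K t] on. With [Km] the largest
    of these, [A] at a late index loses only half as much in the exponent, and the surplus factor
    [expR (g * d k)] exceeds the number [M] of parts. *)
Lemma large_split (R : realType) (L : R) (d : nat -> nat) (I : nat -> finType)
    (A : forall k, {set I k}) (M : nat) (B : 'I_M -> forall k, {set I k}) :
  (forall n, exists K, forall k, (K <= k)%N -> (n <= d k)%N) ->
  (forall k i, i \in A k -> exists t, i \in B t k) ->
  large L d A -> exists t, large L d (B t).
Proof.
move=> dinf AB lA; apply: contrapT => /forallNP nB.
have /choice[K HK] : forall t, exists K, forall k, (K <= k)%N ->
    #|B t k|%:R < expR ((L - K.+1%:R^-1) * (d k)%:R).
  move=> t; have /existsNP[K HK] := nB t; exists K => k kK.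
  by rewrite ltNge; apply/negP => h; apply: HK; exists k.
pose Km := \max_t K t.
have [K1 HK1] := dinf (2 * Km.+1 * M)%N.
have [k [kK]] := lA (maxn (2 * Km).+1 K1).
set K' := maxn _ _ in kK *.
have dk : (2 * Km.+1 * M <= d k)%N.
  by apply: HK1; apply: leq_trans kK; rewrite leq_maxr.
pose g : R := (2 * Km.+1)%:R^-1.
have g0 : 0 < g by rewrite invr_gt0 ltr0n.
have gE : Km.+1%:R^-1 = 2 * g by rewrite /g natrM invfM mulrA divff ?mul1r.
have Mg : M%:R <= g * (d k)%:R.
  by rewrite /g mulrC ler_pdivlMr ?ltr0n// -natrM ler_nat mulnC.
apply/negP; rewrite -ltNge.
apply: (@le_lt_trans _ _ (M%:R * expR ((L - 2 * g) * (d k)%:R))).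
  apply: (@le_trans _ _ (\sum_t #|B t k|)%:R).
    rewrite ler_nat.
    apply: leq_trans (leq_card_bigcup _).
    apply/subset_leq_card/fintype.subsetP => i /AB[t it].
    by apply/finset.bigcupP; exists t.
  rewrite natr_sum mulr_natl -[X in _ *+ X]card_ord -sumr_const.
  apply: ler_sum => t _.
  have KKm : (K t <= Km)%N by exact: leq_bigmax.
  apply: (le_trans (ltW (HK t k _))).
    by apply: leq_trans kK; rewrite leq_max; apply/orP; left; lia.
  rewrite ler_expR ler_wpM2r ?ler0n// lerB// -gE lef_pV2 ?posrE ?ltr0n//.
  by rewrite ler_nat.
apply: (@lt_le_trans _ _ (expR ((L - g) * (d k)%:R))); last first.
  rewrite ler_expR ler_wpM2r ?ler0n// lerB// /g lef_pV2 ?posrE ?ltr0n//.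
  by rewrite ler_nat; rewrite /K'; lia.
have -> : (L - g) * (d k)%:R = g * (d k)%:R + (L - 2 * g) * (d k)%:R by ring.
rewrite expRD ltr_pM2r ?expR_gt0//; apply: (le_lt_trans Mg).
by apply: (lt_le_trans _ (expR_ge1Dx _)); rewrite ltrDr.
Qed.

Lemma disjoint_pigeonhole (V : finType) (M : nat) (A : 'I_M -> {set V}) :
  (0 < M)%N -> (forall t t' v, v \in A t -> v \in A t' -> t = t') ->
  exists t, (#|A t| * M <= #|V|)%N.
Proof.
move=> M0 Adisj; apply: contrapT => /forallNP H.
have h1 : (\sum_t #|A t| <= #|V|)%N.
  under eq_bigr do rewrite -sum1_card big_mkcond.
  rewrite exchange_big /= -sum1_card; apply: leq_sum => v _.
  have [/existsP[t vt]|] := boolP [exists t, v \in A t].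
    rewrite (bigD1 t)//= vt big1 // => t' t't.
    by case: ifP => // /Adisj /(_ vt) tt; rewrite tt eqxx in t't.
  by rewrite negb_exists => /forallP nv; rewrite big1// => t _; rewrite (negbTE (nv t)).
have h2 : (\sum_(t < M) #|V|.+1 <= \sum_t #|A t| * M)%N.
  by apply: leq_sum => t _; rewrite ltnNge; exact/negP/H.
move: h2; rewrite sum_nat_const card_ord -big_distrl /= mulnC leq_pmul2r// ltnNge.
by rewrite h1.
Qed.

Lemma greedy_domination (V J : finType) (s : J -> V -> V) (good : {set V})
    (r : nat) : (r * r <= #|J|)%N ->
  (forall v, v \in good -> injective (fun j => s j v)) ->
  exists W : {set V}, (#|W| * r <= #|V|)%N /\
    (#|[set v in good | [forall j, s j v \notin W]]%SET| * r <= #|V|)%N.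
Proof.
(* Take a largest [W] each of whose elements accounts for [r] dominated
   vertices; by double counting, too many undominated vertices would let one
   enlarge it. *)
move=> rJ sinj.
pose dom (W : {set V}) := [set v in good | [exists j, s j v \in W]]%SET.
pose ok (W : {set V}) := (#|W| * r <= #|dom W|)%N.
have ok0 : ok finset.set0 by rewrite /ok cards0.
pose W := [arg max_(W > finset.set0 | ok W) #|W|]%N.
have [okW maxW] : ok W /\ forall W', ok W' -> (#|W'| <= #|W|)%N.
  by rewrite /W; case: arg_maxnP.
exists W; split; first exact: leq_trans okW (max_card _).
set U := [set v in _ | _]%SET; rewrite leqNgt; apply/negP => dU.
pose new w := [set v in U | [exists j, s j v == w]]%SET.
have [w] : exists w, (r < #|new w|)%N.
  apply: contrapT => /forallNP hr.
  have h1 : (#|J| * #|U| <= r * #|V|)%N.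
    apply: (@leq_trans (\sum_w #|new w|)); last first.
      rewrite mulnC -sum_nat_const; apply: leq_sum => w _.
      by rewrite leqNgt; exact/negP/hr.
    have -> : (\sum_w #|new w| = \sum_(v in U) #|[set w | [exists j, s j v == w]]%SET|)%N.
      under eq_bigr do rewrite -sum1_card.
      rewrite (exchange_big_dep (mem U))/= => [|w v _]; last first.
        by rewrite inE => /andP[].
      apply: eq_bigr => v vU; rewrite -sum1_card.
      by apply: eq_bigl => w; rewrite !inE; move: vU; rewrite inE => ->.
    rewrite mulnC -sum_nat_const; apply: leq_sum => v.
    rewrite inE => /andP[vg _].
    rewrite -(card_imset _ (sinj v vg)); apply/subset_leq_card/fintype.subsetP.
    by move=> _ /imsetP[j _ ->]; rewrite inE; apply/existsP; exists j.
  have h2 : (r * r * #|U| <= r * #|V|)%N.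
    by apply: leq_trans h1; rewrite leq_mul2r rJ orbT.
  move: h2; rewrite -mulnA leq_mul2l => /orP[/eqP r0|]; first by move: dU; rewrite r0 muln0.
  by rewrite mulnC leqNgt dU.
move=> rw.
have wW : w \notin W.
  have /card_gt0P[v] : (0 < #|new w|)%N by apply: leq_ltn_trans rw.
  rewrite !inE => /andP[/andP[_ /forallP vW] /existsP[j /eqP <-]].
  exact: vW.
have /maxW : ok (w |: W).
  rewrite /ok cardsU1 wW mulnDl mul1n.
  apply: (@leq_trans (#|new w| + #|dom W|)); first exact: leq_add (ltnW rw) okW.
  have /eqP dj : #|new w :|: dom W|%SET == (#|new w| + #|dom W|)%N.
    rewrite (leq_card_setU (new w) (dom W)) disjoint_subset.
    apply/fintype.subsetP => v; rewrite !inE => /andP[/andP[_ /forallP vW] _].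
    by rewrite negb_and negb_exists; apply/orP; right; apply/forallP.
  rewrite -dj; apply/subset_leq_card/fintype.subsetP => v.
  rewrite !inE => /orP[/andP[/andP[-> _] /existsP[j vw]]|/andP[-> /existsP[j vW]]];
    by apply/existsP; exists j; rewrite !inE ?vw ?vW ?orbT.
by rewrite cardsU1 wW ltnn.
Qed.

(** * Topology *)

Lemma hausdorff_of_separation (Z : topologicalType) :
  (forall z z' : Z, z <> z' -> exists (W : topologicalType) (k : Z -> W),
     [/\ hausdorff_space W, continuous k & k z <> k z']) ->
  hausdorff_space Z.
Proof.
move=> sep z z' zz'; apply: contrapT => /sep[W [k [hW ck]]]; apply.
apply: hW => A B kA kB.
have [y [Ay By]] := zz' _ _ (ck _ _ kA) (ck _ _ kB).
by exists (k y).
Qed.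

(* The factor separating points by [p] and by the functions [h \o a g] lies
   between [X] and [Y]; it is not [Y] because of [x1] and [x2]. *)
Lemma prime_extension_separates (R : realType) (G : groupType)
    (X Y : topologicalType) (a : G -> X -> X) (b : G -> Y -> Y) (p : X -> Y)
    (h : X -> R) (x1 x2 : X) :
  compact [set: X] -> hausdorff_space Y -> continuous_action a ->
  topologically_prime_extension a b p -> continuous h ->
  p x1 = p x2 -> h x1 <> h x2 ->
  forall x x', p x = p x' -> (forall g, h (a g x) = h (a g x')) -> x = x'.
Proof.
move=> cX hY [a1 aM ac] [[cp sp pa] prim] ch p12 h12.
pose e (x x' : X) := `[< p x = p x' /\ forall g, h (a g x) = h (a g x') >].
have e_refl : reflexive e by move=> x; apply/asboolP.
have e_sym : symmetric e.
  by move=> x y; apply/asboolP/asboolP => -[pxy hxy]; split => // g; rewrite hxy.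
have e_trans : transitive e.
  move=> y x z /asboolP[pxy hxy] /asboolP[pyz hyz]; apply/asboolP.
  by split => [|g]; [rewrite pxy | rewrite hxy].
pose E := EquivRel e e_refl e_sym e_trans.
pose Z := quotient_topology {eq_quot E}%qT.
pose q : X -> Z := \pi_Z%qT.
pose r : Z -> X := generic_quotient.repr.
have qE x x' : q x = q x' <-> p x = p x' /\ forall g, h (a g x) = h (a g x').
  split=> [/eqquotP/asboolP//|H]; apply/eqquotP; exact/asboolP.
have qr (z : Z) : q (r z) = z by exact: reprK.
have prq x : p (r (q x)) = p x by have /qE[] := qr (q x).
have hrq x g : h (a g (r (q x))) = h (a g x) by have /qE[_] := qr (q x).
have qa g x : q (a g (r (q x))) = q (a g x).
  apply/qE; split; first by rewrite !pa prq.
  by move=> g'; rewrite -!aM hrq.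
have cq : continuous q by exact: pi_continuous.
pose c g (z : Z) := q (a g (r z)).
(* Universal property of the quotient topology. *)
have cont (W : topologicalType) (k : Z -> W) (k' : X -> W) :
    continuous k' -> (forall x, k (q x) = k' x) -> continuous k.
  move=> ck' kk'; apply/quotient_continuous.
  by have -> : k \o \pi_Z%qT = k' by apply/funext => x; exact: kk'.
have cgc g : continuous (c g).
  apply: (cont _ _ (q \o a g)); last exact: qa.
  by move=> x; apply: continuous_comp; [exact: ac | exact: cq].
have cpr : continuous (p \o r : Z -> Y) by exact: (cont _ _ p).
have chr g : continuous (fun z : Z => h (a g (r z))).
  apply: (cont _ _ (h \o a g)); last by move=> x; exact: hrq.
  by move=> x; apply: continuous_comp; [exact: ac | exact: ch].
have [] := prim Z c q (p \o r).
- have -> : [set: Z] = q @` [set: X].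
    by apply/seteqP; split => // z _; exists (r z).
  by apply: continuous_compact => //; exact: continuous_subspaceT.
- apply: hausdorff_of_separation => z z' zz'.
  have [pzz'|pzz'] := pselect (p (r z) = p (r z')).
    have [g hg] : exists g, h (a g (r z)) <> h (a g (r z')).
      apply: contrapT => /forallNP H; apply: zz'.
      rewrite -(qr z) -(qr z'); apply/qE; split=> // g; exact: contrapT.
    exists R, (fun z => h (a g (r z))); split=> //; exact: Rhausdorff.
  by exists Y, (p \o r).
- split=> [z|s t z|g]; last exact: cgc.
    by rewrite /c a1 qr.
  by rewrite /c aM qa.
- split=> //; first by move=> z; exists (r z).
  by move=> g x; rewrite /c qa.
- split=> //; first by move=> y; have [x <-] := sp y; exists (q x); exact: prq.
  by move=> g z /=; rewrite -pa prq.
- exact: prq.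
(* If [q] is an isomorphism, it is injective, which is the claim. If [p \o r] is one, then
   [q x1 = q x2], against [h x1 <> h x2]. *)
- by move=> [_ [k [qk _ _]]] x x' pxx' hxx'; rewrite -(qk x) -(qk x'); congr k; apply/qE.
- move=> [_ [k [qk _ _]]] x x' _ _; case: h12.
  have /qE[_ /(_ 1%g)] : q x1 = q x2.
    by rewrite -(qk (q x1)) -(qk (q x2)) /= !prq p12.
  by rewrite !a1.
Qed.

(** A point is either a common zero, near which [O] holds, or has a neighbourhood where some [u m]
    stays away from zero, which a large [n] rules out; compactness makes [n] uniform. Applied to
    pairs of points, this yields most of the uniform scales below. *)
Lemma compact_uniformly (R : realType) (T : topologicalType) (u : nat -> T -> R)
    (O : T -> Prop) :
  compact [set: T] -> (forall n, continuous (u n)) ->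
  (forall x, (forall n, u n x = 0) -> \forall x' \near x, O x') ->
  exists n, forall x, (forall m, (m <= n)%N -> `|u m x| <= n.+1%:R^-1) -> O x.
Proof.
move=> /compact_near_coveringP cT cu uO.
pose P n x := (forall m, (m <= n)%N -> `|u m x| <= n.+1%:R^-1) -> O x.
have [|n _ Hn] := cT nat \oo P _ _; last first.
  by exists n => x; apply: (Hn n) => //=.
move=> x _.
have [u0|] := pselect (forall n, u n x = 0).
  exists (O, setT); first by split; [exact: uO | exact: filterT].
  by move=> [y n] [Oy _] _.
move=> /existsNP[m /eqP um]; rewrite -normr_gt0 in um.
have cm : continuous (fun y => `|u m y|).
  by move=> y; apply: continuous_comp; [exact: cu | exact: norm_continuous].
have um2 : `|u m x| / 2 < `|u m x| by rewrite ltr_pdivrMr// ltr_pMr// ltr1n.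
exists ([set y | `|u m x| / 2 < `|u m y|],
        [set n | (m <= n)%N /\ n.+1%:R^-1 < `|u m x| / 2]).
  split; first exact: (cvgr_gt _ (cm x)).
  apply: filterI; first exact: nbhs_infty_ge.
  exact: (near_infty_natSinv_lt (PosNum (divr_gt0 um (ltr0n _ 2)))).
move=> [y n] [/= uy [mn nu]] /(_ m mn); rewrite leNgt.
by rewrite (lt_trans nu uy).
Qed.

Section metric_space.
Variable (R : realType).

Lemma continuous_mdist_comp (T : topologicalType) (Y : metricType R)
    (f g : T -> Y) : continuous f -> continuous g ->
  continuous (fun z => mdist (f z) (g z)).
Proof.
move=> cf cg z; apply/cvgrPdist_lt => e e0.
have e2 : 0 < e / 2 by rewrite divr_gt0.
near=> z'.
have h1 : mdist (f z) (f z') < e / 2.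
  near: z'; exact: (@metricType_numDomainType.cvgr_dist_lt _ _ _ _ _ _ _ (cf z)).
have h2 : mdist (g z) (g z') < e / 2.
  near: z'; exact: (@metricType_numDomainType.cvgr_dist_lt _ _ _ _ _ _ _ (cg z)).
have t1 := metric_triangle (f z) (f z') (g z).
have t2 := metric_triangle (f z') (g z') (g z).
have t3 := metric_triangle (f z') (f z) (g z').
have t4 := metric_triangle (f z) (g z) (g z').
rewrite (metric_sym (f z') (f z)) in t3.
rewrite (metric_sym (g z') (g z)) in t2.
by rewrite ltr_norml; apply/andP; split; lra.
Unshelve. all: by end_near. Qed.

(** A finite net in the form of a labelling, which is what a code can record: [r x] is the index of
    the first centre within [e / 2] of [x]. *)
Lemma compact_net (X : metricType R) (e : R) : compact [set: X] -> 0 < e ->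
  exists (K : nat) (r : X -> 'I_K), forall x x', r x = r x' -> mdist x x' < e.
Proof.
move=> cX e0.
have e2 : 0 < e / 2 by rewrite divr_gt0.
(* Finite lists ordered by inclusion: a near covering along this filter is a finite net. *)
pose F := filter_from [set: seq X] (fun s => [set t : seq X | {subset s <= t}]).
have FF : Filter F.
  apply: filter_from_filter; first by exists [::].
  move=> s t _ _; exists (s ++ t) => // w stw.
  by split=> y ys; apply: stw; rewrite mem_cat ys ?orbT.
have [|s _ sX] := (compact_near_coveringP _).1 cX _ F
    (fun s x => exists2 y, y \in s & mdist y x < e / 2) FF.
  move=> x _; exists (ball x (e / 2), [set t : seq X | x \in t]); first split.
  - exact: (nbhsx_ballx x _ e2).
  - by exists [:: x] => // t; apply; rewrite inE.
  - by move=> [y t] []; rewrite ballEmdist /= => xy xt; exists x.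
pose nr (x y : X) := mdist y x < e / 2.
have fs x : (find (nr x) s < size s)%N.
  by rewrite -has_find; have [y ys yx] := sX s (fun _ h => h) x I; apply/hasP; exists y.
exists (size s), (fun x => Ordinal (fs x)) => x x' [] xx'.
have H y : nr y (nth x s (find (nr y) s)) by apply: nth_find; rewrite has_find.
have := H x'; have := H x; rewrite -xx' /nr => h1 h2.
apply: (le_lt_trans (metric_triangle _ (nth x s (find (nr x) s)) _)).
by rewrite metric_sym; lra.
Qed.

End metric_space.

(** * Staircase functions *)

Section uniform_limit.
Variables (R : realType) (X : topologicalType) (f : nat -> X -> R).
Hypothesis f_step : forall j x, `|f j.+1 x - f j x| <= 2^-1 ^+ j.

Let f_tail j k x : `|f (j + k)%N x - f j x| <= 2 * 2^-1 ^+ j.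
Proof.
(* The subtracted term makes the bound inductive. *)
have H : `|f (j + k)%N x - f j x| <= 2 * (2^-1 ^+ j - 2^-1 ^+ (j + k)).
  elim: k => [|k IH]; first by rewrite addn0 !subrr normr0 mulr0.
  have -> : f (j + k.+1)%N x - f j x
      = (f (j + k).+1 x - f (j + k)%N x) + (f (j + k)%N x - f j x).
    by rewrite addnS; ring.
  apply: (le_trans (ler_normD _ _)); apply: (le_trans (lerD (f_step _ _) IH)).
  rewrite addnS [X in _ <= _ * (_ - X)]exprS.
  by set z := _ ^+ (j + k); lra.
apply: (le_trans H); rewrite ler_pM2l// gerBl.
by rewrite exprn_ge0// invr_ge0.
Qed.

Let pow_small (e : R) : 0 < e -> exists j, 2 * 2^-1 ^+ j < e.
Proof.
move=> e0; have : (fun j => (2^-1 : R) ^+ j) @ \oo --> (0 : R).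
  by apply: cvg_expr; rewrite ger0_norm ?invr_ge0// invf_lt1// ltr1n.
move=> /cvgrPdist_lt/(_ (e / 2)) [|j _ /(_ j (leqnn j))]; first by rewrite divr_gt0.
rewrite sub0r normrN /= ger0_norm ?exprn_ge0 ?invr_ge0// => h; exists j.
by rewrite mulrC -ltr_pdivlMr.
Qed.

Lemma geometric_uniform_limit : (forall j, continuous (f j)) ->
  exists h : X -> R, continuous h /\ forall x, f ^~ x @ \oo --> h x.
Proof.
move=> cf.
have cvgf x : cvgn (f ^~ x).
  apply/cauchy_cvgP/cauchy_exP => e e0; have [j je] := pow_small e0.
  exists (f j x); exists j => // k /= jk; rewrite /ball/=.
  by rewrite distrC -(subnKC jk); apply: le_lt_trans je; exact: f_tail.
exists (fun x => limn (f ^~ x)); split=> // x.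
have hf j y : `|limn (f ^~ y) - f j y| <= 2 * 2^-1 ^+ j.
  have : (fun k => `|f k y - f j y|) @ \oo --> `|limn (f ^~ y) - f j y|.
    by apply: cvg_norm; apply: cvgB; [exact: cvgf | exact: cvg_cst].
  move=> /cvgr_to_le; apply.
  by exists j => // k /= jk; rewrite -(subnKC jk); exact: f_tail.
apply/cvgrPdist_lt => e e0.
have e3 : 0 < e / 3 by rewrite divr_gt0.
have [j je] := pow_small e3.
near=> y.
have := hf j x; have := hf j y.
have : `|f j x - f j y| < e / 3.
  near: y; exact: (@cvgr_dist_lt _ _ _ _ _ _ _ (cf j x)).
rewrite !ler_norml ltr_norml => /andP[? ?] /andP[? ?] /andP[? ?].
by rewrite ltr_norml; apply/andP; split; lra.
Unshelve. all: by end_near. Qed.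

End uniform_limit.

Section staircase.
Variable R : realType.
Implicit Types (n M t i : nat) (y z : R).

Definition clamp z : R := Num.max 0 (Num.min 1 z).

Lemma clamp_ge0 z : 0 <= clamp z. Proof. by rewrite le_max lexx. Qed.

Lemma clamp_le1 z : clamp z <= 1.
Proof. by rewrite ge_max ler01 ge_min lexx. Qed.

Lemma clamp_eq0 z : z <= 0 -> clamp z = 0.
Proof. by move=> z0; rewrite /clamp max_l// ge_min z0 orbT. Qed.

Lemma clamp_eq1 z : 1 <= z -> clamp z = 1.
Proof. by move=> z1; rewrite /clamp min_l// max_r. Qed.

Lemma continuous_clamp : continuous clamp.
Proof.
move=> z; apply: continuous_max; first exact: cvg_cst.
by apply: continuous_min; [exact: cvg_cst | exact: cvg_id].
Qed.

(* Each of the [n] steps has [M] possible positions [t] for its rise, so that a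
   map to the unit interval meets some [rises n M t] at rate at most [1 / M]. *)
Definition stair n M t y : R :=
  n%:R^-1 * \sum_(i < n) clamp (n%:R * M%:R * y - (i * M + t)%:R).

Definition rises n M t : set R :=
  [set y | exists i, (i * M + t)%:R < n%:R * M%:R * y < (i * M + t).+1%:R].

Lemma continuous_stair n M t : continuous (stair n M t).
Proof.
move=> y; apply: cvgM; first exact: cvg_cst.
apply: cvg_big => [|i _]; first exact: add_continuous.
apply: (@cvg_comp _ _ _ (fun x : R => n%:R * M%:R * x - (i * M + t)%:R) clamp);
  last exact: continuous_clamp.
apply: cvgB; last exact: cvg_cst.
by apply: cvgM; [exact: cvg_cst | exact: cvg_id].
Qed.

Lemma stair0 n M t : stair n M t 0 = 0.
Proof.
rewrite /stair big1 ?mulr0// => i _; apply: clamp_eq0.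
by rewrite sub0r oppr_le0.
Qed.

Lemma stair1 n M t : (0 < n)%N -> (t < M)%N -> stair n M t 1 = 1.
Proof.
move=> n0 tM; rewrite /stair (eq_bigr (fun=> 1)).
  by rewrite sumr_const card_ord mulVf// pnatr_eq0 -lt0n.
move=> i _; apply: clamp_eq1; rewrite mulr1 lerBrDr -natrM -(natrD _ 1).
rewrite ler_nat; have := ltn_ord i; nia.
Qed.

Lemma stair_itv n M t y : (0 < n)%N -> 0 <= stair n M t y <= 1.
Proof.
rewrite /stair => n0; apply/andP; split.
  by rewrite mulr_ge0 ?invr_ge0//; apply: sumr_ge0 => i _; exact: clamp_ge0.
rewrite mulrC ler_pdivrMr ?ltr0n// mul1r.
have -> : n%:R = \sum_(i < n) (1 : R) by rewrite sumr_const card_ord.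
by apply: ler_sum => i _; exact: clamp_le1.
Qed.

(** With [k] the integer part of [n * y], the steps of index below [k] are complete and those of
    index above [k] have not begun, so both the sum and [n * y] lie between [k] and [k + 1]. *)
Lemma stair_dist n M t y : (0 < n)%N -> (t < M)%N -> 0 <= y <= 1 ->
  `|stair n M t y - y| <= n%:R^-1.
Proof.
move=> n0 tM /andP[y0 y1].
have nR : 0 < n%:R :> R by rewrite ltr0n.
have M0 : 0 < M%:R :> R by rewrite ltr0n (leq_ltn_trans _ tM).
pose k := Num.truncn (n%:R * y).
have /andP[kl ku] : k%:R <= n%:R * y < k.+1%:R.
  by apply: truncn_itv; rewrite mulr_ge0.
have kn : (k <= n)%N.
  by rewrite -(ler_nat R); apply: (le_trans kl); rewrite ger_pMr.
set S := \sum_(i < n) clamp (n%:R * M%:R * y - (i * M + t)%:R).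
have count m : (\sum_(i < n) (i < m)%N%:R = (minn m n)%:R :> R).
  rewrite -natr_sum; congr (_%:R).
  rewrite -(big_mkord xpredT (fun i => (i < m)%N : nat)) -big_mkcond/=.
  rewrite sum1_count -size_filter.
  elim: n {n0 nR kl ku kn S y1 k} => [|n IH]; first by rewrite minn0.
  by rewrite /index_iota subn0 -addn1 iotaD filter_cat size_cat -{1}(subn0 n) IH
    /=; case: ltnP; rewrite /=; lia.
have lS : k%:R <= S.
  have := count k; rewrite (minn_idPl kn) => <-; apply: ler_sum => i _.
  case: ltnP => [ik|_]; last exact: clamp_ge0.
  rewrite clamp_eq1// lerBrDr -(natrD _ 1).
  apply: (@le_trans _ _ (k%:R * M%:R)).
    by rewrite -natrM ler_nat; nia.
  by rewrite mulrAC ler_pM2r.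
have uS : S <= k.+1%:R.
  apply: (@le_trans _ _ (minn k.+1 n)%:R); last by rewrite ler_nat geq_minl.
  rewrite -count; apply: ler_sum => i _.
  case: ltnP => [ik|ik]; first exact: clamp_le1.
  rewrite clamp_eq0// subr_le0.
  apply: (@le_trans _ _ (k.+1%:R * M%:R)).
    by rewrite mulrAC ler_pM2r// ltW.
  by rewrite -natrM ler_nat; nia.
rewrite /stair -/S.
have -> : n%:R^-1 * S - y = n%:R^-1 * (S - n%:R * y).
  by field; rewrite gt_eqF.
rewrite normrM gtr0_norm ?invr_gt0// ger_pMr ?invr_gt0//.
have k1 : k.+1%:R = k%:R + 1 :> R by rewrite -natr1.
by rewrite ler_norml; apply/andP; split; lra.
Qed.

(** Off the rises every summand is 0 or 1. *)
Lemma stair_off_rises n M t y : ~ rises n M t y ->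
  exists k : 'I_n.+1, stair n M t y = k%:R / n%:R.
Proof.
move=> yT.
pose c (i : 'I_n) := (i * M + t).+1%:R <= n%:R * M%:R * y.
have cE (i : 'I_n) : clamp (n%:R * M%:R * y - (i * M + t)%:R) = (c i)%:R.
  rewrite /c; case: leP => h.
    by rewrite clamp_eq1// lerBrDr -(natrD _ 1).
  rewrite clamp_eq0// subr_le0 leNgt; apply/negP => h'; apply: yT.
  by exists i; rewrite h' h.
have kn : (\sum_i c i < n.+1)%N.
  rewrite ltnS -[leqRHS](card_ord n) -sum1_card; apply: leq_sum => i _.
  by case: (c i).
exists (Ordinal kn); rewrite /stair mulrC; congr (_ / _).
by rewrite natr_sum; apply: eq_bigr.
Qed.

(** In the variable [n * M * y] the rises are open unit cells, whose indices are congruent to [t]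
    modulo [M]. *)
Lemma rises_disjoint n M t t' y : (t < M)%N -> (t' < M)%N ->
  rises n M t y -> rises n M t' y -> t = t'.
Proof.
move=> tM t'M [i /andP[h1 h2]] [j /andP[h3 h4]].
have := lt_trans h1 h4; have := lt_trans h3 h2; rewrite !ltr_nat => h5 h6.
have e : (i * M + t)%N = (j * M + t')%N by lia.
by have := congr1 (modn^~ M) e; rewrite !modnMDl !modn_small.
Qed.

End staircase.

(** * Families of almost equivariant maps *)

Lemma countable_surj (T : choiceType) (x0 : T) : countable [set: T] ->
  exists g : nat -> T, forall x, exists n, g n = x.
Proof.
move=> /countable_injP[f finj].
exists (fun n => xget x0 [set x | f x = n]) => x; exists (f x).
by apply: finj; rewrite ?in_setT//; exact: (@xgetI _ x0 [set y | f y = f x] x).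
Qed.

Section families.
Variables (R : realType) (G : groupType) (X : metricType R).
Implicit Types (a : G -> X -> X) (L eps : R).

Lemma max_dist_lt d eps (phi psi : 'I_d -> X) : 0 < eps ->
  max_dist phi psi < eps <-> forall v, mdist (phi v) (psi v) < eps.
Proof.
move=> e0; split=> [H v|H]; last by apply: bigmax_lt.
by apply: le_lt_trans H; exact: le_bigmax.
Qed.

(** A strict lower bound on a supremum of infima fixes [eps] and then serves every [F] and [delta];
    the upper limit, an infimum of suprema over tails, supplies [i] beyond any [i0]. The separated
    set is listed as a family over ['I_n]. *)
Lemma sofic_entropy_gt a (d : nat -> nat) (sigma : forall i, G -> {perm 'I_(d i)})
    L : d @ \oo --> \oo -> (L%:E < sofic_entropy a sigma)%E ->
  exists2 eps : R, 0 < eps & forall (F : set G) (delta : R) (i0 : nat),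
    finite_set F -> 0 < delta ->
    exists i, (i0 <= i)%N /\ exists (n : nat) (Phi : 'I_n -> 'I_(d i) -> X),
      [/\ forall j, Map a F delta (sigma i) (Phi j),
          forall j j', j != j' -> eps <= max_dist (Phi j) (Phi j')
        & expR (L * (d i)%:R) <= n%:R].
Proof.
move=> dinf /ereal_sup_gt[_ [eps /= e0 <-] Lt]; exists eps => // F delta i0 fF d0.
have {}Lt : (L%:E < limn_esup (fun i => ((d i)%:R^-1)%:E
    * lne (sep_number eps (Map a F delta (sigma i)))))%E.
  apply: (lt_le_trans Lt); apply: (@le_trans _ _ (ereal_inf [set
        limn_esup (fun i => ((d i)%:R^-1)%:E
                     * lne (sep_number eps (Map a F delta (sigma i))))%E
      | delta in [set delta : R | 0 < delta]])).
    by apply: ereal_inf_lbound; exists F.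
  by apply: ereal_inf_lbound; exists delta.
have [i1 _ Hi1] : \forall i \near \oo, (0 < d i)%N by exact: (dinf _ (nbhs_infty_gt 0)).
have : (L%:E < ereal_sup ((fun i => ((d i)%:R^-1)%:E
    * lne (sep_number eps (Map a F delta (sigma i)))) @`
      [set i | (maxn i0 i1 <= i)%N]))%E.
  apply: (lt_le_trans Lt); apply: ereal_inf_lbound.
  exists [set i | (maxn i0 i1 <= i)%N] => //; exact: nbhs_infty_ge.
move=> /ereal_sup_gt[_ [i /= + <-] {}Lt].
rewrite geq_max => /andP[i0i i1i]; exists i; split=> //.
have di := Hi1 i i1i; have dR : 0 < (d i)%:R :> R by rewrite ltr0n.
have : ((expR (L * (d i)%:R))%:E < sep_number eps (Map a F delta (sigma i)))%E.
  rewrite ltNge; apply/negP => H; move: Lt; apply/negP; rewrite -leNgt.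
  have : (lne (sep_number eps (Map a F delta (sigma i))) <= (L * (d i)%:R)%:E)%E.
    rewrite -[X in (_ <= X%:E)%E](expRK (L * (d i)%:R)) -lne_EFin ?expR_gt0//.
    rewrite lee_lne// in_itv/= leey andbT.
      apply: ereal_sup_ubound; exists 0%N => //; exists set0; split=> //.
      by rewrite II0.
    by rewrite lee_fin expR_ge0.
  move=> /(lee_wpmul2l _) -/(_ ((d i)%:R^-1)%:E) H'.
  apply: (le_trans (H' _)); first by rewrite lee_fin invr_ge0.
  by rewrite -EFinM mulrCA mulVf ?mulr1// gt_eqF.
move=> /ereal_sup_gt[_ [n [E [EA En sE]] <-]]; rewrite lte_fin => Ln.
exists n.
have : ([set: 'I_n] #= E)%card.
  by rewrite card_eq_sym; apply: card_eq_trans En _; exact: card_II.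
move=> /card_bijP[f fbij].
have fE j : E (set_val (f (to_setT j))) by exact: set_valP.
exists (fun j => set_val (f (to_setT j))); split; last exact: ltW.
- by move=> j; apply: EA.
- move=> j j' /eqP jj'; apply: sE => // /val_inj /(bij_inj fbij) H; apply: jj'.
  exact: (congr1 set_val H).
Qed.

Lemma sofic_entropy_lt a (d : nat -> nat) (sigma : forall i, G -> {perm 'I_(d i)})
    L eps : d @ \oo --> \oo -> (sofic_entropy a sigma < L%:E)%E -> 0 < eps ->
  exists (F : set G) (delta : R) (i0 : nat),
    [/\ finite_set F, 0 < delta & forall i, (i0 <= i)%N ->
     forall (n : nat) (Phi : 'I_n -> 'I_(d i) -> X),
       (forall j, Map a F delta (sigma i) (Phi j)) ->
       (forall j j', j != j' -> eps <= max_dist (Phi j) (Phi j')) ->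
       n%:R <= expR (L * (d i)%:R)].
Proof.
move=> dinf Lt e0.
have : (ereal_inf [set
      ereal_inf [set
        limn_esup (fun i => ((d i)%:R^-1)%:E
                     * lne (sep_number eps (Map a F delta (sigma i))))%E
      | delta in [set delta : R | (0 < delta)%R]]
    | F in [set F : set G | finite_set F]] < L%:E)%E.
  by apply: le_lt_trans Lt; apply: ereal_sup_ubound; exists eps.
move=> /ereal_inf_lt[_ [F /= fF <-]] /ereal_inf_lt[_ [delta /= d0 <-]].
move=> /ereal_inf_lt[_ [V [i0 _ Vi] <-]] sL.
have [i1 _ Hi1] : \forall i \near \oo, (0 < d i)%N by exact: (dinf _ (nbhs_infty_gt 0)).
exists F, delta, (maxn i0 i1); split=> // i; rewrite geq_max => /andP[i0i i1i].
move=> n Phi PM Psep; have di := Hi1 i i1i.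
have dR : 0 < (d i)%:R :> R by rewrite ltr0n.
have [n0|n0] := posnP n; first by rewrite n0 expR_ge0.
have nR : 0 < n%:R :> R by rewrite ltr0n.
have : (((d i)%:R^-1)%:E * lne (sep_number eps (Map a F delta (sigma i))) < L%:E)%E.
  by apply: le_lt_trans sL; apply: ereal_sup_ubound; exists i => //; exact: Vi.
have : (n%:R%:E <= sep_number eps (Map a F delta (sigma i)))%E.
  apply: ereal_sup_ubound; exists n => //; exists (range Phi); split.
  - by move=> _ [j _ <-].
  - suff H : (range Phi #= [set: 'I_n])%card.
      by apply: card_eq_trans H _; rewrite card_eq_sym; exact: card_II.
    apply: inj_card_eq => j j' _ _ jj'; apply/eqP; apply: contrapT => /negP /Psep.
    rewrite jj' leNgt; apply/negP; rewrite negbK.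
    by apply/max_dist_lt => // v; rewrite mdistxx.
  - by move=> _ _ [j _ <-] [j' _ <-] jj'; apply: Psep; apply/eqP => jj; rewrite jj in jj'.
move=> h1 h2.
have {}h1 : (lne n%:R%:E <= lne (sep_number eps (Map a F delta (sigma i))))%E.
  rewrite lee_lne// in_itv/= leey andbT ?lee_fin//.
  by apply: le_trans h1; rewrite lee_fin.
rewrite lne_EFin// in h1.
have : (((d i)%:R^-1)%:E * (ln n%:R)%:E < L%:E)%E.
  by apply: le_lt_trans h2; apply: lee_wpmul2l => //; rewrite lee_fin invr_ge0.
rewrite -EFinM lte_fin mulrC ltr_pdivrMr// => h3.
by rewrite -ler_ln ?posrE ?expR_gt0// expRK ltW.
Qed.

Lemma max_dist_refl d (phi : 'I_d -> X) : max_dist phi phi = 0.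
Proof.
apply/eqP; rewrite eq_le; apply/andP; split; last exact: bigmax_ge_id.
by apply/bigmax_leP; split=> // v _; rewrite mdistxx.
Qed.

Lemma max_dist_sym d (phi psi : 'I_d -> X) : max_dist phi psi = max_dist psi phi.
Proof. by apply: eq_bigr => v _; exact: metric_sym. Qed.

(** A maximal [eps]-separated subfamily is an [eps]-net of the family, and each member is coded by
    an element of the net close to it; hence the factor 2. *)
Lemma Map_coded a (d : nat -> nat) (sigma : forall i, G -> {perm 'I_(d i)}) L eps :
  d @ \oo --> \oo -> (sofic_entropy a sigma < L%:E)%E -> 0 < eps ->
  exists (F : set G) (delta : R) (i0 : nat),
    [/\ finite_set F, 0 < delta & forall i, (i0 <= i)%N ->
     forall (I : finType) (Phi : I -> 'I_(d i) -> X),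
       (forall j, Map a F delta (sigma i) (Phi j)) ->
       coded [set: I]%SET (expR (L * (d i)%:R))
         (fun j j' => forall v, mdist (Phi j v) (Phi j' v) < 2 * eps)].
Proof.
move=> dinf Lt e0; have [F [delta [i0 [fF d0 H]]]] := sofic_entropy_lt dinf Lt e0.
exists F, delta, i0; split=> // i i0i I Phi PM.
pose sep (S : {set I}) := [forall j in S, forall j' in S,
  (j != j') ==> (eps <= max_dist (Phi j) (Phi j'))].
have sep0 : sep finset.set0 by apply/forall_inP => j; rewrite inE.
pose S := [arg max_(S > finset.set0 | sep S) #|S|]%N.
have [sepS maxS] : sep S /\ forall S', sep S' -> (#|S'| <= #|S|)%N.
  by rewrite /S; case: arg_maxnP.
have near j : exists j', j' \in S /\ max_dist (Phi j) (Phi j') < eps.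
  have [jS|jS] := boolP (j \in S); first by exists j; rewrite max_dist_refl.
  apply: contrapT => /forallNP jfar.
  have /maxS : sep (j |: S)%SET.
    apply/forall_inP => j1 /setU1P j1S; apply/forall_inP => j2 /setU1P j2S.
    apply/implyP => j12.
    case: j1S j12 => [->|j1S]; case: j2S => [->|j2S] j12.
    - by rewrite eqxx in j12.
    - by rewrite leNgt; apply/negP => h; apply: (jfar j2).
    - by rewrite max_dist_sym leNgt; apply/negP => h; apply: (jfar j1).
    - by move/forall_inP: sepS => /(_ _ j1S)/forall_inP/(_ _ j2S)/implyP; apply.
  by rewrite cardsU1 jS ltnn.
have [e He] := choice near.
exists I, e; split.
  apply: (@le_trans _ _ #|S|%:R).
    rewrite ler_nat; apply/subset_leq_card/fintype.subsetP => _ /imsetP[j _ ->].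
    by have [] := He j.
  apply: (H i i0i #|S| (fun j => Phi (enum_val j))) => [j|j j' jj']; first exact: PM.
  move/forall_inP: sepS => /(_ _ (enum_valP j))/forall_inP/(_ _ (enum_valP j')).
  by move/implyP; apply; rewrite (inj_eq enum_val_inj).
move=> j j' _ _ ejj' v.
have [_ /(max_dist_lt _ _ e0) /(_ v) h1] := He j.
have [_ /(max_dist_lt _ _ e0) /(_ v) h2] := He j'.
rewrite -ejj' in h2; rewrite (metric_sym (Phi j' v)) in h2.
by apply: (le_lt_trans (metric_triangle _ (Phi (e j) v) _)); lra.
Qed.

Lemma Map_subset a (F F' : set G) (delta delta' : R) d (s : G -> {perm 'I_d}) :
  F `<=` F' -> delta' <= delta -> Map a F' delta' s `<=` Map a F delta s.
Proof. by move=> FF' dd phi HM g /FF'/HM h; exact: le_trans dd. Qed.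

(** Chebyshev's inequality for each [g] in [F], then a union bound. *)
Lemma Map_few_bad a (F : seq G) (kappa : R) (m : nat) : 0 < kappa ->
  exists2 delta : R, 0 < delta &
  forall d (s : G -> {perm 'I_d}) phi, Map a [set` F] delta s phi ->
    (#|[set v | has (fun g => (kappa <= mdist (phi (s g v)) (a g (phi v)))%R) F]%SET|
       * m <= d)%N.
Proof.
(* Each [g] in [F] may spoil a proportion [1 / q] of the vertices; the successor below keeps the
   quotient positive when [q] is zero. *)
move=> k0; pose q := (size F * m)%N.
exists (kappa / q.+1%:R); first by rewrite divr_gt0.
move=> d s phi HM.
pose bad g := [set v | kappa <= mdist (phi (s g v)) (a g (phi v))]%SET.
have badq g : g \in F -> (#|bad g| * q <= d)%N.
  move=> gF; have := HM g gF.
  set S := \sum_(v < d) _ => H.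
  have S0 : 0 <= S by apply: sumr_ge0 => v _; exact: sqr_ge0.
  have [d0|d0] := posnP d.
    suff -> : #|bad g| = 0%N by [].
    by apply/eqP; rewrite -leqn0 -[leqRHS]d0 -[leqRHS]card_ord; exact: max_card.
  have dR : 0 < d%:R :> R by rewrite ltr0n.
  have {}H : d%:R^-1 * S <= (kappa / q.+1%:R) ^+ 2.
    rewrite -[leLHS]sqr_sqrtr ?mulr_ge0 ?invr_ge0//.
    by rewrite lerXn2r ?nnegrE ?sqrtr_ge0 ?divr_ge0 ?(ltW k0).
  have SB : #|bad g|%:R * kappa ^+ 2 <= S.
    rewrite /S (bigID (mem (bad g)))/= -[leLHS]addr0; apply: lerD.
      rewrite mulr_natl -sumr_const; apply: ler_sum => v; rewrite inE => h.
      by rewrite lerXn2r ?nnegrE ?mdist_ge0 ?(ltW k0).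
    by apply: sumr_ge0 => v _; exact: sqr_ge0.
  rewrite mulrC ler_pdivrMr// in H.
  have {}H : #|bad g|%:R * q.+1%:R ^+ 2 <= d%:R :> R.
    have : #|bad g|%:R * kappa ^+ 2 <= (kappa / q.+1%:R) ^+ 2 * d%:R.
      exact: le_trans H.
    rewrite expr_div_n mulrAC ler_pdivlMr ?exprn_gt0// mulrAC (mulrC _ d%:R).
    by rewrite ler_pM2r// exprn_gt0.
  rewrite -natrX -natrM ler_nat in H; apply: leq_trans H.
  by rewrite leq_mul2l; apply/orP; right; rewrite expnS expn1; nia.
have cover :
    (#|[set v | has (fun g => (kappa <= mdist (phi (s g v)) (a g (phi v)))%R) F]%SET|
    <= \sum_(g <- F) #|bad g|)%N.
  elim: F {q HM badq} => [|g F IH].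
    by rewrite big_nil leqn0 cards_eq0; apply/eqP/setP => v; rewrite !inE.
  rewrite big_cons; apply: (@leq_trans (#|bad g| +
      #|[set v | has (fun g => (kappa <= mdist (phi (s g v)) (a g (phi v)))%R) F]%SET|)).
    apply: (leq_trans _ (leq_card_setU _ _)).
    by apply/subset_leq_card/fintype.subsetP => v; rewrite !inE.
  by rewrite leq_add2l.
have [m0|m0] := posnP m; first by rewrite m0 muln0.
have [F0|F0] := posnP (size F).
  apply: (@leq_trans (0 * m)); last by [].
  rewrite leq_mul2r; apply/orP; right; apply: (leq_trans cover).
  by rewrite (size0nil F0) big_nil.
rewrite -(leq_pmul2l F0).
apply: (@leq_trans ((\sum_(g <- F) #|bad g|) * q)).
  by rewrite /q mulnCA leq_mul2r cover orbT.
rewrite big_distrl/= big_seq.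
apply: (@leq_trans (\sum_(g <- F | g \in F) d)); first exact: leq_sum.
by rewrite -big_seq big_const_seq count_predT iter_addn_0 mulnC.
Qed.

End families.

(** Near a zero of [u] the term [eta] suffices; elsewhere [u] is locally bounded below and [w]
    above, so a large multiple of [u] dominates. Compactness gives a single [C]. *)
Lemma compact_dominated (R : realType) (T : topologicalType) (u w : T -> R)
    (eta : R) :
  compact [set: T] -> continuous u -> continuous w ->
  (forall z, 0 <= u z) -> (forall z, u z = 0 -> w z < eta) ->
  exists C : nat, forall z, w z <= eta + C%:R * u z.
Proof.
move=> /compact_near_coveringP cT cu cw u0 uw.
have [|n _ Hn] := cT nat \oo (fun n z => w z <= eta + n%:R * u z) _ _; last first.
  by exists n => z; apply: (Hn n) => //=.
move=> z _; have [uz|uz] := eqVneq (u z) 0.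
  exists ([set y | w y < eta], setT); last first.
    by move=> [y n] [/= /ltW wy _]; apply: (le_trans wy); rewrite lerDl mulr_ge0.
  by split; [exact: (cvgr_lt _ (cw z)) (uw z uz) | exact: filterT].
have uz0 : 0 < u z by rewrite lt0r uz u0.
have u2 : u z / 2 < u z by rewrite ltr_pdivrMr// ltr_pMr// ltr1n.
have w1 : w z < w z + 1 by rewrite ltrDl.
exists ([set y | u z / 2 < u y] `&` [set y | w y < w z + 1],
        [set n | `|(w z + 1 - eta) / (u z / 2)| <= n%:R]); last first.
  move=> [y n] [[/= uy wy] nb]; rewrite -lerBlDl.
  apply: (@le_trans _ _ (w z + 1 - eta)); first by rewrite lerB// ltW.
  apply: (@le_trans _ _ (n%:R * (u z / 2))); last by rewrite ler_wpM2l// ltW.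
  rewrite -ler_pdivrMr ?divr_gt0//; exact: le_trans (ler_norm _) nb.
split; last exact: nbhs_infty_ger.
by apply: filterI; [exact: (cvgr_gt _ (cu z)) | exact: (cvgr_lt _ (cw z))].
Qed.

(** The squared distance of images is dominated through [compact_dominated] by the squared distance
    of points; averaging over the vertices then preserves almost equivariance in mean square. *)
Lemma Map_comp (R : realType) (G : groupType) (X Y : metricType R)
    (a : G -> X -> X) (b : G -> Y -> Y) (p : X -> Y) (F : set G) (delta : R) :
  compact [set: X] -> continuous p -> (forall g x, p (a g x) = b g (p x)) ->
  0 < delta -> exists2 delta' : R, 0 < delta' &
    forall d (s : G -> {perm 'I_d}) phi,
      Map a F delta' s phi -> Map b F delta s (p \o phi).
Proof.
move=> cX cp pa d0.
have [eta eta0 etaE] : exists2 eta : R, 0 < eta & eta + eta = delta ^+ 2.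
  by exists (delta ^+ 2 / 2); [rewrite divr_gt0// exprn_gt0 | lra].
have [C HC] : exists C : nat, forall z : X * X,
    mdist (p z.1) (p z.2) ^+ 2 <= eta + C%:R * mdist z.1 z.2 ^+ 2.
  apply: (@compact_dominated _ _ (fun z : X * X => mdist z.1 z.2 ^+ 2)
    (fun z => mdist (p z.1) (p z.2) ^+ 2)).
  - by rewrite -setXTT; exact: compact_setX.
  - move=> z; apply: (@continuous_comp _ _ _ (fun z : X * X => mdist z.1 z.2)
      (fun r : R => r ^+ 2)); last exact: exprn_continuous.
    by apply: continuous_mdist_comp => ?; [exact: cvg_fst | exact: cvg_snd].
  - move=> z; apply: (@continuous_comp _ _ _ (fun z : X * X => mdist (p z.1) (p z.2))
      (fun r : R => r ^+ 2)); last exact: exprn_continuous.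
    by apply: continuous_mdist_comp => ?; apply: continuous_comp;
      [exact: cvg_fst | exact: cp | exact: cvg_snd | exact: cp].
  - by move=> z; exact: sqr_ge0.
  - move=> [x x'] /= /eqP; rewrite sqrf_eq0 => /eqP /mdist_positivity ->.
    by rewrite mdistxx expr0n.
(* Both resulting terms, [eta] and [C * (eta / C.+1)], are then at most [delta ^+ 2 / 2]. *)
exists (Num.sqrt (eta / C.+1%:R)); first by rewrite sqrtr_gt0 divr_gt0.
move=> d s phi HM g Fg; have := HM g Fg.
set S := \sum_(v < d) mdist _ _ ^+ 2 => HS.
have S0 : 0 <= S by apply: sumr_ge0 => v _; exact: sqr_ge0.
have {}HS : d%:R^-1 * S <= eta / C.+1%:R.
  by move: HS; rewrite ler_sqrt// divr_ge0// ltW.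
rewrite -[leRHS]ger0_norm ?(ltW d0)// -sqrtr_sqr ler_sqrt ?sqr_ge0//.
apply: (@le_trans _ _ (d%:R^-1 *
    (\sum_(v < d) (eta + C%:R * mdist (phi (s g v)) (a g (phi v)) ^+ 2)))).
  rewrite ler_wpM2l ?invr_ge0//; apply: ler_sum => v _ /=.
  by rewrite -pa; exact: (HC (_, _)).
rewrite big_split/= -mulr_sumr -/S sumr_const card_ord -(mulr_natr eta).
have -> : d%:R^-1 * (eta * d%:R + C%:R * S)
  = eta * (d%:R^-1 * d%:R) + C%:R * (d%:R^-1 * S) by ring.
have h1 : eta * (d%:R^-1 * d%:R) <= eta.
  rewrite ger_pMr//; have [->|d1] := eqVneq (d%:R : R) 0; first by rewrite mulr0.
  by rewrite mulVf.
have h2 : C%:R * (d%:R^-1 * S) <= eta.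
  apply: (@le_trans _ _ (C%:R * (eta / C.+1%:R))); first by rewrite ler_wpM2l.
  by rewrite mulrCA ger_pMr// ler_pdivrMr// mul1r ler_nat.
by apply: (le_trans (lerD h1 h2)); rewrite etaE.
Qed.

(** Diagonal choice along an exhaustion of [G] by finite sets, with tolerance [1 / (k + 1)]: one
    sequence of families eventually serves every [F] and [delta]. *)
Lemma sofic_entropy_gt_sequence (R : realType) (G : groupType) (X : metricType R)
    (a : G -> X -> X) (d : nat -> nat) (sigma : forall i, G -> {perm 'I_(d i)})
    (L : R) : countable [set: G] -> d @ \oo --> \oo ->
  (L%:E < sofic_entropy a sigma)%E ->
  exists (eps : R) (idx N : nat -> nat) (Phi : forall k, 'I_(N k) -> 'I_(d (idx k)) -> X),
    [/\ 0 < eps /\ (forall k, k <= idx k)%N,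
        forall F delta, finite_set F -> 0 < delta -> exists K, forall k, (K <= k)%N ->
          forall j, Map a F delta (sigma (idx k)) (Phi k j),
        forall k j j', j != j' -> exists v, eps <= mdist (Phi k j v) (Phi k j' v)
      & forall k, expR (L * (d (idx k))%:R) <= (N k)%:R].
Proof.
move=> cG dinf Lt; have [eps e0 H] := sofic_entropy_gt dinf Lt.
have [g gsurj] := countable_surj 1%g cG.
pose W := {i : nat & {n : nat & 'I_n -> 'I_(d i) -> X}}.
pose P k (w : W) := [/\ (k <= projT1 w)%N,
  forall j, Map a (g @` `I_k) k.+1%:R^-1 (sigma (projT1 w)) (projT2 (projT2 w) j),
  forall j j', j != j' -> eps <= max_dist (projT2 (projT2 w) j) (projT2 (projT2 w) j')
  & expR (L * (d (projT1 w))%:R) <= (projT1 (projT2 w))%:R].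
have /choice[w Hw] : forall k, exists w, P k w.
  move=> k; have [||i [ki [n [Phi [h1 h2 h3]]]]] := H (g @` `I_k) k.+1%:R^-1 k.
  - exact: finite_image.
  - by rewrite invr_gt0.
  - by exists (existT _ i (existT _ n Phi)).
exists eps, (fun k => projT1 (w k)), (fun k => projT1 (projT2 (w k))),
  (fun k => projT2 (projT2 (w k))); split.
- by split=> // k; have [] := Hw k.
- move=> F delta /finite_seqP[A ->] d0.
  have /choice[c Hc] := gsurj.
  pose K1 := (\max_(x <- A) (c x).+1)%N.
  have [K2 _ HK2] : \forall k \near \oo, k.+1%:R^-1 < delta.
    exact: (near_infty_natSinv_lt (PosNum d0)).
  exists (maxn K1 K2) => k; rewrite geq_max => /andP[K1k K2k] j.
  have [_ HM _ _] := Hw k; apply: Map_subset (HM j).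
    move=> x /= xA; exists (c x) => //=.
    by apply: leq_trans K1k; rewrite /K1; apply: leq_bigmax_seq.
  exact/ltW/HK2.
- move=> k j j' jj'; have [_ _ /(_ _ _ jj') h _] := Hw k.
  apply: contrapT => /forallNP nv; move: h; apply/negP; rewrite -ltNge.
  by apply/max_dist_lt => // v; rewrite ltNge; exact/negP.
- by move=> k; have [] := Hw k.
Qed.

(** * Entropy inequality *)

(** This is [compact_uniformly] for the single function [mdist], whose zeros form the diagonal. *)
Lemma compact_equicontinuous (R : realType) (X : metricType R) (J : finType)
    (w : J -> X * X -> R) (e : R) :
  compact [set: X] -> (forall j, continuous (w j)) -> (forall j x, w j (x, x) < e) ->
  exists2 delta : R, 0 < delta &
    forall x x', mdist x x' < delta -> forall j, w j (x, x') < e.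
Proof.
move=> cX cw w0.
have cXX : compact [set: X * X] by rewrite -setXTT; exact: compact_setX.
have [|[x x'] /(_ 0%N)/= /mdist_positivity <-|n Hn] :=
  @compact_uniformly R _ (fun _ (z : X * X) => mdist z.1 z.2)
    (fun z => forall j, w j z < e) cXX.
- move=> _; apply: continuous_mdist_comp => ?; [exact: cvg_fst | exact: cvg_snd].
- have H j : \forall z \near (x, x), w j z < e.
    exact: (cvgr_lt _ (cw j (x, x))) (w0 j x).
  exact: filter_forall H.
- exists n.+1%:R^-1; first by rewrite invr_gt0.
  move=> x x' xx' j; apply: (Hn (x, x')) => m _ /=.
  by rewrite ger0_norm ?mdist_ge0// ltW.
Qed.

(** * Contradiction from an extension that raises entropy *)

Section contradiction.
Variables (R : realType) (G : groupType) (X Y : metricType R).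
Variables (a : G -> X -> X) (b : G -> Y -> Y) (p : X -> Y).
(** The data extracted from a supposed gap h(Y) < [LY] < [L] < h(X), along indices tending to
    infinity; [Phi_coded] carries the bound for [Y]. *)
Variables (D N : nat -> nat) (s : forall k, G -> {perm 'I_(D k)}).
Variable (Phi : forall k, 'I_(N k) -> 'I_(D k) -> X).
Variables (L LY eps : R).
Hypothesis cX : compact [set: X].
Hypothesis ac : continuous_action a.
Hypothesis cp : continuous p.
Hypothesis pa : forall g x, p (a g x) = b g (p x).
Hypothesis eps0 : 0 < eps.
Hypothesis LYL : LY < L.
Hypothesis D_large : forall n, exists K, forall k, (K <= k)%N -> (n <= D k)%N.
Hypothesis Phi_Map : forall F delta, finite_set F -> 0 < delta ->
  exists K, forall k, (K <= k)%N -> forall j, Map a F delta (s k) (@Phi k j).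
Hypothesis Phi_sep : forall k (j j' : 'I_(N k)), j != j' ->
  exists v, eps <= mdist (Phi j v) (Phi j' v).
Hypothesis N_large : forall k, expR (L * (D k)%:R) <= (N k)%:R.
Hypothesis Phi_coded : forall e, 0 < e -> exists K, forall k, (K <= k)%N ->
  coded [set: 'I_(N k)]%SET (expR (LY * (D k)%:R))
    (fun j j' => forall v, mdist (p (Phi j v)) (p (Phi j' v)) < e).

Lemma few_bad (F : seq G) (kappa : R) (m : nat) : 0 < kappa ->
  exists K, forall k, (K <= k)%N -> forall j : 'I_(N k),
   (#|[set v | has (fun g => (kappa <= mdist (Phi j (s k g v)) (a g (Phi j v)))%R) F]%SET|
       * m <= D k)%N.
Proof.
move=> k0; have [delta d0 H] := Map_few_bad a F m k0.
have [K HK] := Phi_Map (finite_seq F) d0.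
by exists K => k Kk j; apply: H; exact: HK.
Qed.

(** A large subfamily has at least [expR ((L - K.+1%:R^-1) * (D k)%:R)] members at some [k] beyond
    [K]; once [K.+1%:R^-1] is below the gap [L - (LY + c)], they outnumber the code words. *)
Lemma no_injective_coding (S : forall k, {set 'I_(N k)}) (c : R) :
  LY + c < L -> large L D S ->
  ~ exists K, forall k, (K <= k)%N ->
    coded (S k) (expR ((LY + c) * (D k)%:R)) (fun j j' => j = j').
Proof.
move=> cL lS [K HK].
have gap : 0 < L - (LY + c) by rewrite subr_gt0.
have [K1 _ HK1] : \forall k \near \oo, k.+1%:R^-1 < L - (LY + c).
  exact: (near_infty_natSinv_lt (PosNum gap)).
have [K2 HK2] := D_large 1.
have [k [Kk Sk]] := lS (maxn K (maxn K1 K2)).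
move: Kk; rewrite !geq_max => /and3P[Kk K1k K2k].
have := le_trans Sk (coded_card (HK k Kk)).
rewrite ler_expR ler_pM2r ?ltr0n; last exact: HK2.
apply/negP; rewrite -ltNge; have := HK1 (maxn K (maxn K1 K2)).
rewrite /= !leq_max leqnn orbT => /(_ isT).
by rewrite ltrBrDr ltrBrDl.
Qed.

Lemma large_setT : large L D (fun k => [set: 'I_(N k)]%SET).
Proof.
move=> K; exists K; split=> //; rewrite cardsT card_ord.
apply: le_trans (N_large K); rewrite ler_expR ler_wpM2r//.
by rewrite gerBl.
Qed.

(** Three codes determine a member: its image in [Y], the nearby non-injective point at the vertices
    of a dominating set, and the position at a few exceptional vertices. Infiniteness of [G] makes
    the dominating set sparse: for the trivial group, mapping two points to one is a prime extension
    that raises the entropy from 0 to log 2. *)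
Lemma finite_noninjective_absurd :
  infinite_set [set: G] ->
  (forall g h, g <> h -> forall m : nat, exists K, forall k, (K <= k)%N ->
    (#|[set v | s k g v == s k h v :> 'I_(D k)]%SET| * m <= D k)%N) ->
  ~ finite_set [set x | exists2 x', x' <> x & p x' = p x].
Proof.
move=> infG free /finite_seqP[zs0 D0E].
have [a1 aM acont] := ac.
pose zs := undup zs0; pose z := tnth (in_tuple zs).
have zinj : injective z by apply/tuple_uniqP; exact: undup_uniq.
have zP x x' : x' <> x -> p x' = p x -> exists i, z i = x.
  move=> xx' pxx'; have : [set` zs0] x by rewrite -D0E; exists x'.
  rewrite /= -mem_undup => /seq_tnthP[i ->]; by exists i.
have az g i : exists i', z i' = a g (z i).
  have : [set` zs0] (z i) by rewrite /= -mem_undup; exact: (mem_tnth i (in_tuple zs)).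
  rewrite -D0E => -[x' xz pxz]; apply: (zP _ (a g x')); last by rewrite !pa pxz.
  by move=> /(congr1 (a g^-1%g)); rewrite -!aM mulVg !a1.
(* Two sparse codes of rate [c] will be used, and [LY + 2 * c < L]. *)
pose c := (L - LY) / 4.
have c0 : 0 < c by rewrite divr_gt0// subr_gt0.
have [m1 Hm1] := coded_sparse 'I_(size zs) c0.
have [K0 [r rP]] := compact_net cX eps0.
have [m2 Hm2] := coded_sparse 'I_K0 c0.
(* Domination at rate [1 / r0] takes [r0 * r0] translates; the factor 3 pays for three kinds of
   exceptional vertices. *)
pose mm := maxn m1 m2; pose r0 := (3 * mm)%N; pose q := (r0 * r0)%N.
have [gam gam_inj] : exists gam : 'I_q -> G, injective gam.
  have [B _ qB] := infinite_set_fset q infG.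
  exists (fun t => nth 1%g (finmap.enum_fset B) t) => t t' /eqP.
  rewrite nth_uniq ?finmap.fset_uniq//; first by move/eqP; exact: val_inj.
  - exact: leq_trans (ltn_ord t) qB.
  - exact: leq_trans (ltn_ord t') qB.
(* At scale [k1] a point is close to at most one [z i]. *)
have [k1 k10 Hk1] : exists2 k1 : R, 0 < k1 &
    forall i j, i != j -> 2 * k1 <= mdist (z i) (z j).
  exists (\big[Num.min/1]_(ij | ij.1 != ij.2) (mdist (z ij.1) (z ij.2) / 2)).
    apply/bigmin_gtP; split=> // -[i j] /= ij; rewrite divr_gt0// mdist_gt0.
    by rewrite (inj_eq zinj).
  move=> i j ij; rewrite mulrC -ler_pdivlMr//.
  exact: (@bigmin_le_cond _ _ _ 1 (i, j) _ (fun ij => mdist (z ij.1) (z ij.2) / 2)).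
have [k2 k20 Hk2] : exists2 k2 : R, 0 < k2 & forall x x', mdist x x' < k2 ->
    forall t : 'I_q, mdist (a (gam t) x) (a (gam t) x') < k1 / 2.
  apply: (compact_equicontinuous
    (w := fun t z => mdist (a (gam t) z.1) (a (gam t) z.2))) => //.
    move=> t; apply: continuous_mdist_comp => ?; apply: continuous_comp;
      by [exact: cvg_fst | exact: cvg_snd | exact: acont].
  by move=> t x; rewrite mdistxx divr_gt0.
pose k3 := Num.min k2 (eps / 2).
have k30 : 0 < k3 by rewrite lt_min k20 divr_gt0.
(* Compactness of the space of pairs: if [p x = p x'], then either [x = x'] or both points are among
   the [z i]. *)
have [del del0 Hdel] : exists2 del : R, 0 < del & forall x x',
    mdist (p x) (p x') < del -> mdist x x' < eps \/
    (exists i, mdist x (z i) < k3) /\ (exists i, mdist x' (z i) < k3).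
  have cXX : compact [set: X * X] by rewrite -setXTT; exact: compact_setX.
  have cm (x0 : X) : continuous (fun y : X => mdist y x0).
    by apply: continuous_mdist_comp => ?; [exact: cvg_id | exact: cvg_cst].
  have [|[x x'] /(_ 0%N)/= /mdist_positivity pxx'|n Hn] :=
    @compact_uniformly R _ (fun _ (y : X * X) => mdist (p y.1) (p y.2))
    (fun y => mdist y.1 y.2 < eps \/
    (exists i, mdist y.1 (z i) < k3) /\ (exists i, mdist y.2 (z i) < k3)) cXX.
  - move=> _; apply: continuous_mdist_comp => ?; apply: continuous_comp;
      by [exact: cvg_fst | exact: cvg_snd | exact: cp].
  - have [<-|/eqP xx'] := eqVneq x x'.
      near=> y; left; near: y.
      apply: (cvgr_lt (mdist x x)); last by rewrite mdistxx.
      apply: (@continuous_mdist_comp _ (X * X)%type X fst snd _ _ (x, x)).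
      by move=> ?; exact: cvg_fst. by move=> ?; exact: cvg_snd.
    have [i zi] := zP _ _ (fun e => xx' (esym e)) (esym pxx').
    have [i' zi'] := zP _ _ xx' pxx'.
    exists ([set y | mdist y x < k3], [set y | mdist y x' < k3]).
      split; [apply: (cvgr_lt (mdist x x)) | apply: (cvgr_lt (mdist x' x'))];
        by [exact: cm | rewrite mdistxx].
    by move=> [y y'] [/= h h']; right; split;
      [exists i; rewrite zi | exists i'; rewrite zi'].
  - exists n.+1%:R^-1; first by rewrite invr_gt0.
    move=> x x' xx'; apply: (Hn (x, x')) => m _ /=.
    by rewrite ger0_norm ?mdist_ge0// ltW.
have [K1 HK1] := Phi_coded del0.
have k12 : 0 < k1 / 2 by rewrite divr_gt0.
have [K2 HK2] := few_bad [seq gam t | t <- enum 'I_q] r0 k12.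
(* Here the [q] translates are distinct, as [greedy_domination] requires; asymptotic freeness makes
   the other vertices rare. *)
pose good k := [set v : 'I_(D k) | injectiveb (fun t : 'I_q => s k (gam t) v)]%SET.
have [K3 HK3] : exists K3, forall k, (K3 <= k)%N -> (#|~: good k| * r0 <= D k)%N.
  pose col k (tt : 'I_q * 'I_q) := if tt.1 == tt.2 then finset.set0 else
    [set v : 'I_(D k) | s k (gam tt.1) v == s k (gam tt.2) v]%SET.
  have /choice[Kf HKf] : forall tt, exists K, forall k, (K <= k)%N ->
      (#|col k tt| * (#|{: 'I_q * 'I_q}| * r0) <= D k)%N.
    move=> [t t']; rewrite /col /=; have [_|tt'] := eqVneq t t'.
      by exists 0%N => k _; rewrite cards0.
    by apply: free => /gam_inj tt; rewrite tt eqxx in tt'.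
  exists (\max_tt Kf tt)%N => k Kk.
  have [q0|q0] := posnP #|{: 'I_q * 'I_q}|.
    suff -> : (~: good k)%SET = finset.set0 by rewrite cards0.
    apply/setP => v; rewrite !inE; apply/negbF/injectiveP => t.
    by have := max_card (pred1 (t, t)); rewrite q0 card1.
  rewrite -(leq_pmul2l q0) mulnCA.
  apply: (@leq_trans ((\sum_tt #|col k tt|) * (#|{: 'I_q * 'I_q}| * r0))).
    rewrite leq_mul2r; apply/orP; right.
    apply: leq_trans (leq_card_bigcup _).
    apply/subset_leq_card/fintype.subsetP => v; rewrite !inE => /injectivePn[t [t' tt' e]].
    by apply/finset.bigcupP; exists (t, t') => //; rewrite /col /= (negbTE tt') inE e.
  rewrite big_distrl /=; apply: (@leq_trans (\sum_(tt : 'I_q * 'I_q) D k)); last first.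
    by rewrite sum_nat_const.
  apply: leq_sum => tt _; apply: HKf; exact: leq_trans (leq_bigmax tt) Kk.
apply: (no_injective_coding (c := c + c) _ large_setT);
  first by have := LYL; rewrite /c; lra.
exists (maxn K1 (maxn K2 K3)) => k; rewrite !geq_max => /and3P[/HK1 yc /HK2 fb /HK3 gd].
have [||W [Wr Ur]] := @greedy_domination _ _ (fun t : 'I_q => s k (gam t)) (good k) r0.
- by rewrite card_ord.
- by move=> v; rewrite inE => /injectiveP.
set U := [set v in _ | _]%SET in Ur.
rewrite card_ord in Wr Ur.
pose bad j := [set v | has (fun g => (k1 / 2 <= mdist (Phi j (s k g v)) (a g (Phi j v)))%R)
  [seq gam t | t <- enum 'I_q]]%SET.
(* The exceptional vertices: undominated, with coinciding translates, or with a failure of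
   equivariance. *)
pose flag j := (U :|: ~: good k :|: bad j)%SET.
(* [c1] records the nearby point of [z] on a dominating set, [c2] the position
   at the few exceptional vertices. *)
pose c1 (j : 'I_(N k)) (v : 'I_(D k)) : option 'I_(size zs) :=
  if v \in W then [pick i | mdist (Phi j v) (z i) < k1] else None.
pose c2 (j : 'I_(N k)) (v : 'I_(D k)) : option 'I_K0 :=
  if v \in flag j then Some (r (Phi j v)) else None.
have cc1 : coded [set: 'I_(N k)]%SET (expR (c * (D k)%:R))
    (fun j j' => forall v, c1 j v = c1 j' v).
  apply: (Hm1 _ mm) => [|j _]; first by rewrite leq_maxl.
  apply: leq_trans Wr; apply: (@leq_trans (#|W| * mm)).
    rewrite leq_mul2r; apply/orP; right.
    by apply/subset_leq_card/fintype.subsetP => v; rewrite inE /c1; case: ifP.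
  by rewrite leq_mul2l /r0; apply/orP; right; lia.
have cc2 : coded [set: 'I_(N k)]%SET (expR (c * (D k)%:R))
    (fun j j' => forall v, c2 j v = c2 j' v).
  apply: (Hm2 _ mm) => [|j _]; first by rewrite leq_maxr.
  apply: (@leq_trans (#|flag j| * mm)).
    rewrite leq_mul2r; apply/orP; right.
    by apply/subset_leq_card/fintype.subsetP => v; rewrite inE /c2; case: ifP.
  have := fb j; rewrite -/(bad j) => fbj.
  have h : (#|flag j| <= #|U| + #|~: good k| + #|bad j|)%N.
    apply: (leq_trans (leq_card_setU _ _)); rewrite leq_add2r.
    exact: leq_card_setU.
  rewrite -(leq_pmul2l (isT : 0 < 3)%N); rewrite /r0 in Ur gd fbj; nia.
apply: coded_sub (coded_and yc (coded_and cc1 cc2)).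
  by rewrite -!expRD -!mulrDl.
move=> j j' _ _ [yjj' [c1jj' c2jj']]; apply/eqP; apply: contrapT => /negP /Phi_sep[v vjj'].
have unflag (i i' : 'I_(N k)) : c2 i v = c2 i' v -> eps <= mdist (Phi i v) (Phi i' v) ->
    v \notin flag i.
  move=> e h; apply/negP => vf; move: e; rewrite /c2 vf; case: ifP => // _ [] /rP.
  by rewrite ltNge h.
have vj := unflag _ _ (c2jj' v) vjj'.
have vj' : v \notin flag j'.
  by apply: unflag (esym (c2jj' v)) _; rewrite metric_sym.
have [/lt_geF|[[i vi] [i' vi']]] := Hdel _ _ (yjj' v); first by rewrite vjj'.
have ii' : i != i'.
  apply/eqP => ii'; rewrite -ii' in vi'; move: vjj'; apply/negP; rewrite -ltNge.
  apply: (le_lt_trans (metric_triangle _ (z i) _)); rewrite (metric_sym (z i)).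
  by move: vi vi'; rewrite !lt_min => /andP[_ h1] /andP[_ h2]; lra.
have [t tW] : exists t : 'I_q, s k (gam t) v \in W.
  move: vj; rewrite !inE !negb_or => /andP[/andP[h1 h2] _].
  rewrite negbK in h2; rewrite h2 /= negb_forall in h1.
  by have /existsP[t] := h1; rewrite negbK => tW; exists t.
(* Equivariance carries a point near [z i0] to one near its translate, with total error below
   [k1 / 2 + k1 / 2], so the label at the dominating vertex is that of the translate. *)
have lab (l : 'I_(N k)) (i0 : 'I_(size zs)) : v \notin flag l ->
    mdist (Phi l v) (z i0) < k3 ->
    exists2 i1, z i1 = a (gam t) (z i0) & c1 l (s k (gam t) v) = Some i1.
  move=> vl; rewrite lt_min => /andP[/Hk2/(_ t) h1 _].
  have [i1 zi1] := az (gam t) i0; exists i1 => //.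
  have h2 : mdist (Phi l (s k (gam t) v)) (a (gam t) (Phi l v)) < k1 / 2.
    rewrite ltNge; apply/negP => h; move/negP: vl; apply; rewrite !inE; apply/orP; right.
    by apply/hasP; exists (gam t) => //; apply: map_f; rewrite mem_enum.
  have h3 : mdist (Phi l (s k (gam t) v)) (z i1) < k1.
    rewrite zi1; apply: (le_lt_trans (metric_triangle _ (a (gam t) (Phi l v)) _)); lra.
  rewrite /c1 tW; case: pickP => [i2 h4|/(_ i1)]; last by rewrite h3.
  congr Some; apply/eqP; apply: contrapT => /negP /Hk1; apply/negP; rewrite -ltNge.
  apply: (le_lt_trans (metric_triangle _ (Phi l (s k (gam t) v)) _)).
  by rewrite (metric_sym (z i2)); lra.
have [i1 zi1 e1] := lab _ _ vj vi.
have [i2 zi2 e2] := lab _ _ vj' vi'.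
(* Equal labels at the dominating vertex mean equal translates; undoing the translation gives
   [z i = z i'], against [ii']. *)
move: (c1jj' (s k (gam t) v)); rewrite e1 e2 => -[i12].
move: zi2; rewrite -i12 zi1 => /(congr1 (a (gam t)^-1%g)); rewrite -!aM mulVg !a1.
by move=> /zinj /eqP; rewrite (negbTE ii').
Unshelve. all: by end_near. Qed.

(** The entropy accounting for a function [h] coded level by level. The levels below [m1] cost at
    most [c] in total, the visits to [W m1] another [c], and the failures of equivariance a third.
    As [p] and the translates of [h] separate points, a large subfamily would be coded
    injectively. *)
Lemma level_coding_absurd (h : X -> R) (W : nat -> set X) (M q : nat -> nat)
    (As : nat -> forall k, {set 'I_(N k)}) (kap : nat -> R) (c : R) :
  countable [set: G] -> continuous h ->
  (forall x x', p x = p x' -> (forall g, h (a g x) = h (a g x')) -> x = x') ->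
  (forall j, large L D (As j)) -> (forall j k, As j.+1 k \subset As j k) ->
  (forall j k i, i \in As j k ->
    (#|[set v | `[< W j (Phi i v) >]]%SET| * M j <= D k)%N) ->
  (forall j, (j <= M j)%N) ->
  (forall j (I : finType) (d : nat) (S : {set I})
      (e : I -> 'I_d -> option (option 'I_(q j))),
    (forall i, i \in S -> (#|[set v | e i v != None]%SET| * M j <= d)%N) ->
    coded S (expR (kap j * d%:R)) (fun i i' => forall v, e i v = e i' v)) ->
  (forall J, \sum_(j < J) kap j <= c) -> 0 < c -> LY + 3 * c < L ->
  (forall x x', ~ W 0%N x -> ~ W 0%N x' -> h x = h x') ->
  (forall j, exists t : X -> 'I_(q j), forall x x', W j x -> W j x' ->
    ~ W j.+1 x -> ~ W j.+1 x' -> t x = t x' -> h x = h x') -> False.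
Proof.
move=> cG ch sep lA Asub Asparse jM kcoded kap_le c0 c3 W0 Wt.
have [a1 aM acont] := ac.
(* The code at level [J] is nontrivial only at the rare [v] with [Phi i v] in
   [W J]; it says whether [Phi i v] leaves [W J.+1], and then gives [h]. *)
have levels J k : coded (As J k) (expR ((\sum_(j < J) kap j) * (D k)%:R))
    (fun i i' => forall v, ~ W J (Phi i v) -> ~ W J (Phi i' v) ->
       h (Phi i v) = h (Phi i' v)).
  elim: J => [|J IH].
    exists unit, (fun=> tt); split; last by move=> i i' _ _ _ v; exact: W0.
    rewrite big_ord0 mul0r expR0 -[X in _ <= X]/(1%:R) ler_nat.
    by apply: (leq_trans (max_card _)); rewrite card_unit.
  have [t Ht] := Wt J.
  pose e (i : 'I_(N k)) (v : 'I_(D k)) := if `[< W J (Phi i v) >] then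
    Some (if `[< W J.+1 (Phi i v) >] then None else Some (t (Phi i v))) else None.
  have ce := kcoded J _ _ (As J k) e.
  have := coded_and IH (ce _).
  rewrite -expRD -mulrDl => H; rewrite big_ord_recr /=.
  apply: (coded_subset (Asub J k)); apply: coded_sub (H _) => //; last first.
    move=> i iA; apply: leq_trans (Asparse J k i iA); rewrite leq_mul2r.
    apply/orP; right; apply/subset_leq_card/fintype.subsetP => v.
    by rewrite !inE /e; case: asboolP.
  move=> i i' _ _ [Hi He] v Wv Wv'.
  have := He v; rewrite /e.
  case: (asboolP (W J.+1 (Phi i v))) => // _.
  case: (asboolP (W J.+1 (Phi i' v))) => // _.
  case: asboolP => JW; case: asboolP => JW' //; last by move=> _; exact: Hi.
  by move=> [tt]; exact: (Ht _ _ JW JW').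
have [g gsurj] := countable_surj 1%g cG.
have cXX : compact [set: X * X] by rewrite -setXTT; exact: compact_setX.
have cdiff (T : topologicalType) (u w : T -> X) : continuous u -> continuous w ->
    continuous (fun y => h (u y) - h (w y)).
  by move=> cu cw y; apply: cvgB; apply: continuous_comp;
    [exact: cu | exact: ch | exact: cw | exact: ch].
have cfst g0 : continuous (fun y : X * X => a g0 y.1).
  by move=> y; apply: continuous_comp; [exact: cvg_fst | exact: acont].
have csnd g0 : continuous (fun y : X * X => a g0 y.2).
  by move=> y; apply: continuous_comp; [exact: cvg_snd | exact: acont].
(* By separation the common zeros of the [u n] lie on the diagonal, so finitely many of them, known
   up to a precision [del], decide closeness up to [eps]. *)
pose u n (y : X * X) := if n is n'.+1 then h (a (g n') y.1) - h (a (g n') y.2)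
  else mdist (p y.1) (p y.2).
have [|[x x'] u0|n Hn] := @compact_uniformly R _ u (fun y => mdist y.1 y.2 < eps) cXX.
- case=> [|n] /=; last exact: cdiff.
  by apply: continuous_mdist_comp => ?; apply: continuous_comp;
    [exact: cvg_fst | exact: cp | exact: cvg_snd | exact: cp].
- have xx' : x = x'.
    apply: sep; first by apply: mdist_positivity; exact: (u0 0%N).
    move=> g0; have [n <-] := gsurj g0; apply/eqP; rewrite -subr_eq0.
    by apply/eqP; exact: (u0 n.+1).
  have cd : continuous (fun y : X * X => mdist y.1 y.2).
    by apply: continuous_mdist_comp => ?; [exact: cvg_fst | exact: cvg_snd].
  rewrite xx'; apply: (cvgr_lt _ (cd (x', x'))).
  by rewrite /= mdistxx.
pose del : R := n.+1%:R^-1.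
have del0 : 0 < del by rewrite invr_gt0.
(* One third for the coded values of [h], two for the equivariance errors of the two members. *)
have del3 : 0 < del / 3 by rewrite divr_gt0.
have [k1 k10 Hk1] : exists2 k1 : R, 0 < k1 &
    forall x x', mdist x x' < k1 -> `|h x - h x'| < del / 3.
  have [||k1 k10 Hk1] :=
    compact_equicontinuous (w := fun (_ : unit) (y : X * X) => `|h y.1 - h y.2|)
      (e := del / 3) cX.
  - move=> _ y; apply: (@continuous_comp _ _ _ (fun y : X * X => h y.1 - h y.2) Num.norm).
      by apply: cdiff => ?; [exact: cvg_fst | exact: cvg_snd].
    exact: norm_continuous.
  - by move=> _ x; rewrite subrr normr0.
  - by exists k1 => // x x' /Hk1/(_ tt).
have [Kn [r rP]] := compact_net cX k10.
have [Ke [r' r'P]] := compact_net cX eps0.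
have [m1 Hm1] := coded_sparse 'I_Kn c0.
have [m2 Hm2] := coded_sparse 'I_Ke c0.
pose F := [seq g i | i <- iota 0 n].
have [K1 HK1] := few_bad F m2 k10.
have [K2 HK2] := Phi_coded del0.
(* The levels stop at [m1]: since [m1 <= M m1], visits to [W m1] are rare enough to be coded by a
   finite net of [X] at rate [c]. *)
apply: (no_injective_coding (c := 3 * c) c3 (lA m1)).
exists (maxn K1 K2) => k; rewrite geq_max => /andP[/HK1 fb /HK2 yc].
pose bad i :=
  [set v | has (fun g => (k1 <= mdist (Phi i (s k g v)) (a g (Phi i v)))%R) F]%SET.
pose e1 (i : 'I_(N k)) (v : 'I_(D k)) :=
  if `[< W m1 (Phi i v) >] then Some (r (Phi i v)) else None.
pose e2 (i : 'I_(N k)) (v : 'I_(D k)) :=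
  if v \in bad i then Some (r' (Phi i v)) else None.
have ce1 : coded (As m1 k) (expR (c * (D k)%:R)) (fun i i' => forall v, e1 i v = e1 i' v).
  apply: (Hm1 _ (M m1)) => // i /(Asparse m1 k i); apply: leq_trans.
  rewrite leq_mul2r; apply/orP; right; apply/subset_leq_card/fintype.subsetP => v.
  by rewrite !inE /e1; case: asboolP.
have ce2 : coded (As m1 k) (expR (c * (D k)%:R)) (fun i i' => forall v, e2 i v = e2 i' v).
  apply: (Hm2 _ m2) => // i _; apply: leq_trans (fb i).
  rewrite leq_mul2r; apply/orP; right; apply/subset_leq_card/fintype.subsetP => v.
  by rewrite inE /e2; case: ifP.
have ycA := coded_subset (finset.subsetT (As m1 k)) yc.
apply: coded_sub (coded_and ycA (coded_and (levels m1 k) (coded_and ce1 ce2))).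
  rewrite -!expRD -!mulrDl ler_expR ler_wpM2r//; have := kap_le m1; lra.
move=> i i' _ _ [yii' [lev [e1ii' e2ii']]].
apply/eqP; apply: contrapT => /negP /Phi_sep[v vii'].
have unbad (l l' : 'I_(N k)) : e2 l v = e2 l' v -> eps <= mdist (Phi l v) (Phi l' v) ->
    v \notin bad l.
  move=> e f; apply/negP => vf; move: e; rewrite /e2 vf; case: ifP => // _ [] /r'P.
  by rewrite ltNge f.
have vi := unbad _ _ (e2ii' v) vii'.
have vi' : v \notin bad i'.
  by apply: unbad (esym (e2ii' v)) _; rewrite metric_sym.
have hii' w : `|h (Phi i w) - h (Phi i' w)| < del / 3.
  have := e1ii' w; rewrite /e1; case: asboolP => Wi; case: asboolP => Wi' //.
    by move=> [/rP/Hk1].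
  by rewrite (lev w Wi Wi') subrr normr0.
have close (l : 'I_(N k)) g0 : v \notin bad l -> g0 \in F ->
    `|h (Phi l (s k g0 v)) - h (a g0 (Phi l v))| < del / 3.
  move=> vl g0F; apply: Hk1; rewrite ltNge; apply/negP => f; move/negP: vl; apply.
  by rewrite inE; apply/hasP; exists g0.
move: vii'; apply/negP; rewrite -ltNge; apply: (Hn (Phi i v, Phi i' v)) => -[|m] mn /=.
  by rewrite ger0_norm ?mdist_ge0// ltW.
have gF : g m \in F by apply: map_f; rewrite mem_iota.
have := close _ _ vi gF; have := close _ _ vi' gF; have := hii' (s k (g m) v).
rewrite -/del !ltr_norml ler_norml => /andP[? ?] /andP[? ?] /andP[? ?].
by apply/andP; split; lra.
Qed.

(** Each member visits one of the [M] disjoint sets at rate at most [1 / M]; [large_split] then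
    makes the choice of set common to a large subfamily. *)
Lemma large_rare_visits (A : forall k, {set 'I_(N k)}) (M : nat) (T : 'I_M -> set X) :
  (0 < M)%N -> (forall t t' x, T t x -> T t' x -> t = t') -> large L D A ->
  exists t, large L D (fun k => A k :&:
    [set i | (#|[set v | `[< T t (Phi i v) >]]%SET| * M <= D k)%N])%SET.
Proof.
move=> M0 Tdisj; apply: large_split D_large _ => k i iA.
have [t t' v|t Ht] := @disjoint_pigeonhole _ M
  (fun t => [set v | `[< T t (Phi i v) >]]%SET) M0.
- by rewrite !inE => /asboolP/asboolP h /asboolP/asboolP h'; exact: Tdisj h h'.
- by exists t; rewrite !inE iA /=; rewrite card_ord in Ht.
Qed.

Lemma infinite_noninjective_absurd :
  countable [set: G] ->
  (forall (h : X -> R) x1 x2, continuous h -> p x1 = p x2 -> h x1 <> h x2 ->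
    forall x x', p x = p x' -> (forall g, h (a g x) = h (a g x')) -> x = x') ->
  ~ infinite_set [set x | exists2 x', x' <> x & p x' = p x].
Proof.
move=> cG sep infD0.
pose c := (L - LY) / 4.
have c0 : 0 < c by rewrite divr_gt0// subr_gt0.
have c3 : LY + 3 * c < L by have := LYL; rewrite /c; lra.
pose kap j : R := c * 2^-1 ^+ j.+1.
have kap0 j : 0 < kap j by rewrite mulr_gt0// exprn_gt0// invr_gt0.
have kap_le J : \sum_(j < J) kap j <= c.
  suff -> : \sum_(j < J) kap j = c * (1 - 2^-1 ^+ J).
    by rewrite ger_pMr// gerBl exprn_ge0// invr_ge0.
  elim: J => [|J IH]; first by rewrite big_ord0 expr0 subrr mulr0.
  by rewrite big_ord_recr /= IH /kap exprS; field.
(* Level [j] has [2 ^ j + 1] staircase values and one symbol for points that stay in the next set.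
   These alphabets are known in advance, so all the [M j] are fixed before the construction. *)
have /choice[m0 Hm0] j := coded_sparse (option 'I_(2 ^ j).+1) (kap0 j).
pose M j := maxn (m0 j) j.+1.
have M0 j : (0 < M j)%N by rewrite /M leq_max orbT.
pose rare j (U : set X) k :=
  [set i : 'I_(N k) | (#|[set v | `[< U (Phi i v) >]]%SET| * M j <= D k)%N]%SET.
have [B BD MB] := infinite_set_fset (M 0%N) infD0.
pose xs (t : 'I_(M 0%N)) : X :=
  tnth (in_tuple (finmap.enum_fset B)) (widen_ord MB t).
have xs_inj : injective xs.
  move=> t t'; rewrite /xs !(tnth_nth (xs t)) /= => /eqP.
  by rewrite nth_uniq ?finmap.fset_uniq ?(leq_trans (ltn_ord _) MB)// => /eqP/val_inj.
have /choice[xs' Hxs'] t : exists x', x' <> xs t /\ p x' = p (xs t).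
  by have [|x' ? ?] := BD (xs t); [exact: mem_tnth | exists x'].
(* The balls of radius [rho] about the [xs t] are disjoint, and each misses the partner [xs' t] of
   its centre. *)
have [rho rho0 [rho1 rho2]] : exists2 rho : R, 0 < rho &
    (forall t t', t != t' -> 2 * rho <= mdist (xs t) (xs t')) /\
    (forall t, rho <= mdist (xs' t) (xs t)).
  pose r1 := \big[Num.min/1]_(tt | tt.1 != tt.2) (mdist (xs tt.1) (xs tt.2) / 2).
  pose r2 := \big[Num.min/1]_t mdist (xs' t) (xs t).
  exists (Num.min r1 r2).
    rewrite lt_min; apply/andP; split; apply/bigmin_gtP; split=> //.
      by move=> [t t'] /= tt'; rewrite divr_gt0// mdist_gt0 (inj_eq xs_inj).
    by move=> t _; rewrite mdist_gt0; apply/eqP; have [] := Hxs' t.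
  split=> [t t' tt'|t].
    rewrite mulrC -ler_pdivlMr// ge_min; apply/orP; left.
    exact: (@bigmin_le_cond _ _ _ 1 (t, t') _ (fun tt => mdist (xs tt.1) (xs tt.2) / 2)).
  by rewrite ge_min; apply/orP; right; exact: bigmin_le_cond.
have [t0 lt0] : exists t, large L D (fun k => [set: 'I_(N k)] :&:
    rare 0%N [set x | mdist x (xs t) < rho]%classic k)%SET.
  apply: (@large_rare_visits _ _ (fun t => [set x | mdist x (xs t) < rho]) (M0 0%N));
    last exact: large_setT.
  move=> t t' x /= h h'; apply/eqP; apply: contrapT => /negP /rho1.
  apply/negP; rewrite -ltNge; apply: (le_lt_trans (metric_triangle _ x _)).
  by rewrite (metric_sym (xs t)); lra.
pose x1 := xs t0; pose x2 := xs' t0.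
have [x21 px21] := Hxs' t0.
(* A state holds the level, the current function, the set where its values are not yet coded, and
   the surviving subfamily. *)
pose St := (nat * ((X -> R) * (set X) * (forall k, {set 'I_(N k)})))%type.
pose Inv (st : St) := let: (j, (f, U, A)) := st in
  [/\ continuous f /\ (forall x, 0 <= f x <= 1), f x1 = 1 /\ f x2 = 0,
      large L D A & forall k, A k \subset rare j U k].
pose f0 x := clamp (1 - mdist x x1 / rho).
have Inv0 : Inv (0%N, (f0, [set x | mdist x x1 < rho],
    (fun k => [set: 'I_(N k)] :&: rare 0%N [set x | mdist x x1 < rho]%classic k)%SET)).
  split=> //.
  - split; last by move=> x; rewrite clamp_ge0 clamp_le1.
    move=> x; apply: (@continuous_comp _ _ _ (fun x => 1 - mdist x x1 / rho) (@clamp R)).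
      apply: cvgB; first exact: cvg_cst.
      apply: cvgM; last exact: cvg_cst.
      have cd : continuous (fun x => mdist x x1).
        by apply: continuous_mdist_comp => ?; [exact: cvg_id | exact: cvg_cst].
      exact: cd.
    exact: continuous_clamp.
  - split; first by rewrite /f0 mdistxx mul0r subr0 clamp_eq1.
    by rewrite /f0 clamp_eq0// subr_le0 ler_pdivlMr// mul1r; exact: rho2.
  - by move=> k; exact: subsetIr.
pose next (st st' : St) := let: (j, (f, U, A)) := st in let: (j', (f', U', A')) := st' in
  [/\ j' = j.+1,
      exists t, (t < M j.+1)%N /\ f' = stair (2 ^ j) (M j.+1) t \o f,
      forall x, U x -> ~ U' x -> exists t : 'I_(2 ^ j).+1, f' x = t%:R / (2 ^ j)%:R
    & forall k, A' k \subset A k].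
(* Among the [M j.+1] positions of the rises, keep one whose preimage in [U] is rarely visited by a
   large subfamily. The [2 ^ j] steps make the successive changes of [f] summable. *)
have step (st : {st | Inv st}) : {st' : {st | Inv st} | next (sval st) (sval st')}.
  apply: cid; case: st => -[j [[f U] A]] [[cf f01] [fx1 fx2] lA rA].
  pose T (t : 'I_(M j.+1)) := U `&` f @^-1` rises (2 ^ j) (M j.+1) t.
  have [|t lT] := @large_rare_visits A _ T (M0 j.+1) _ lA.
    move=> t t' x [_ h] [_ h']; apply: val_inj.
    exact: (rises_disjoint (ltn_ord t) (ltn_ord t') h h').
  pose st' : St := (j.+1, (stair (2 ^ j) (M j.+1) t \o f, T t,
    fun k => A k :&: rare j.+1 (T t) k)%SET).
  have Inv' : Inv st'.
    split=> //; last by move=> k; exact: subsetIr.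
      split; last by move=> x; apply: stair_itv; rewrite expn_gt0.
      move=> x; apply: (@continuous_comp _ _ _ f); first exact: cf.
      exact: continuous_stair.
    by rewrite /= fx1 fx2 stair0 stair1// expn_gt0.
  exists (exist _ st' Inv'); split=> //.
  - by exists t.
  - move=> x Ux nT; apply: stair_off_rises => h; apply: nT; split=> //.
  - by move=> k; exact: subsetIl.
have [st [st0 stS]] := dependent_choice step (exist _ _ Inv0).
have stj j : (sval (st j)).1 = j.
  elim: j => [|j IH]; first by rewrite st0.
  have := stS j; move: IH; case: (sval (st j)) => jj [[f U] A] /= ->.
  by case: (sval (st j.+1)) => jj' [[f' U'] A'] [].
pose f j := (sval (st j)).2.1.1; pose U j := (sval (st j)).2.1.2.
pose A j := (sval (st j)).2.2.
have InvE j : [/\ continuous (f j) /\ (forall x, 0 <= f j x <= 1),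
    f j x1 = 1 /\ f j x2 = 0, large L D (A j) & forall k, A j k \subset rare j (U j) k].
  rewrite /f /U /A; have := svalP (st j); have := stj j.
  by case: (sval (st j)) => jj [[ff UU] AA] /= ->.
have nextE j : [/\ exists t, (t < M j.+1)%N /\ f j.+1 = stair (2 ^ j) (M j.+1) t \o f j,
      forall x, U j x -> ~ U j.+1 x ->
        exists t : 'I_(2 ^ j).+1, f j.+1 x = t%:R / (2 ^ j)%:R
    & forall k, A j.+1 k \subset A j k].
  rewrite /f /U /A; have := stS j; have := stj j.
  case: (sval (st j)) => jj [[ff UU] AA] /= ->.
  by case: (sval (st j.+1)) => jj' [[ff' UU'] AA'] [].
have [|j|h [ch fh]] := @geometric_uniform_limit R X f.
- move=> j x; have [[t [tM ->]] _ _] := nextE j; have [[_ f01] _ _ _] := InvE j.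
  rewrite /= exprVn -natrX; apply: stair_dist => //; by rewrite expn_gt0.
- by have [[]] := InvE j.
(* All later functions factor through [f j], hence so does the limit. *)
have hx x x' j : f j x = f j x' -> h x = h x'.
  move=> fxx'; apply: (@cvg_unique _ (@Rhausdorff R) _ _ _ _ (fh x)).
  apply: (cvg_trans _ (fh x')); apply: near_eq_cvg; exists j => // i /=.
  move=> ji; rewrite -(subnKC ji); elim: (i - j)%N => [|n IH]; first by rewrite addn0.
  by rewrite addnS; have [[t [_ ->]] _ _] := nextE (j + n)%N; rewrite /= IH.
(* Staircases fix 0 and 1, so the limit still separates [x1] from [x2], which have the same image
   under [p]. *)
have h1 : h x1 = 1.
  apply: (@cvg_unique _ (@Rhausdorff R) _ _ _ _ (fh x1)).
  apply: (@cvg_trans _ ((fun=> 1 : R) @ \oo)); last exact: cvg_cst.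
  apply: near_eq_cvg; apply: nearW => j /=.
  by have [_ [-> _]] := InvE j.
have h2 : h x2 = 0.
  apply: (@cvg_unique _ (@Rhausdorff R) _ _ _ _ (fh x2)).
  apply: (@cvg_trans _ ((fun=> 0 : R) @ \oo)); last exact: cvg_cst.
  apply: near_eq_cvg; apply: nearW => j /=.
  by have [_ [_ ->]] := InvE j.
apply: (@level_coding_absurd h U M (fun j => (2 ^ j).+1) A kap c) => //.
- apply: (sep h x1 x2 ch (esym px21)); rewrite h1 h2; apply/eqP; exact: oner_neq0.
- by move=> j; have [] := InvE j.
- by move=> j k; have [] := nextE j.
- move=> j k i iA; have [_ _ _ /(_ k)/fintype.subsetP/(_ i iA)] := InvE j.
  by rewrite inE.
- by move=> j; rewrite /M leq_max leqnSn orbT.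
- by move=> j I d S e Se; apply: (Hm0 j I (M j)) => //; rewrite leq_maxl.
- move=> x x'; rewrite /U st0 /= => Ux Ux'; apply: (hx _ _ 0%N).
  rewrite /f st0 /= /f0 !clamp_eq0// subr_le0 ler_pdivlMr// mul1r leNgt;
    exact/negP.
- move=> j; have [_ Hj _] := nextE j.
  (* The code is the index of a staircase value; the default [ord0] below is never taken on the
     points concerned, where such a value exists. *)
  pose tt x := [pick t : 'I_(2 ^ j).+1 | f j.+1 x == t%:R / (2 ^ j)%:R].
  exists (fun x => odflt ord0 (tt x)) => x x' Ux Ux' nU nU'.
  have [t ft] := Hj x Ux nU; have [t' ft'] := Hj x' Ux' nU'.
  rewrite /tt; case: pickP => [s1 /eqP e1|/(_ t)]; last by rewrite ft eqxx.
  case: pickP => [s2 /eqP e2|/(_ t')]; last by rewrite ft' eqxx.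
  by move=> /= ss; apply: (hx _ _ j.+1); rewrite e1 e2 ss.
Qed.

End contradiction.

(** * The inequality for prime extensions, and prime actions as extensions of a point *)

Lemma ereal_real_between (R : realType) (x y : \bar R) : (x < y)%E ->
  exists r : R, (x < r%:E)%E /\ (r%:E < y)%E.
Proof.
case: x => [x||]; case: y => [y||] //=; rewrite ?lte_fin.
- move=> xy; exists ((x + y) / 2); rewrite !lte_fin; split; lra.
- by move=> _; exists (x + 1); rewrite lte_fin ltrDl ltr01 ltry.
- by move=> _; exists (y - 1); rewrite ltNyr lte_fin ltrBlDr ltrDl ltr01.
- by move=> _; exists 0; rewrite ltNyr ltry.
Qed.

(** Once the proportion of disagreements exceeds [1 - m.+1%:R^-1], that of agreements is below
    [m.+1%:R^-1]. *)
Lemma sofic_approximation_free (R : realType) (G : groupType) (d : nat -> nat)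
    (sigma : forall i, G -> {perm 'I_(d i)}) : sofic_approximation R sigma ->
  forall g h, g <> h -> forall m : nat, exists K, forall i, (K <= i)%N ->
    (#|[set v | sigma i g v == sigma i h v]%SET| * m <= d i)%N.
Proof.
move=> [_ _ free] g h gh m.
have lt1 : 1 - m.+1%:R^-1 < 1 :> R by rewrite gtrBl invr_gt0.
have [K _ HK] := cvgr_gt _ (free g h gh) _ lt1.
exists K => i /HK /=.
set A := [set v | _ != _]%SET; set B := [set v | _ == _]%SET.
have [d0|d0] := posnP (d i).
  suff -> : #|B| = 0%N by [].
  by apply/eqP; rewrite -leqn0 -[leqRHS]d0 -[leqRHS]card_ord; exact: max_card.
have dR : 0 < (d i)%:R :> R by rewrite ltr0n.
have mR : 0 < m.+1%:R :> R by rewrite ltr0n.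
rewrite ltr_pdivlMr// => H.
have AB : (#|A| + #|B| = d i)%N.
  rewrite addnC -[RHS](card_ord (d i)) -(cardsC B); congr (_ + _)%N.
  by apply: eq_card => v; rewrite !inE.
have ABR : #|A|%:R + #|B|%:R = (d i)%:R :> R by rewrite -natrD AB.
have : #|B|%:R < m.+1%:R^-1 * (d i)%:R :> R.
  by move: H; rewrite mulrBl mul1r ltrBlDr -{1}ABR ltrD2l.
rewrite mulrC ltr_pdivlMr// -natrM ltr_nat => /ltnW; apply: leq_trans.
by rewrite leq_mul2l leqnSn orbT.
Qed.

Lemma sofic_entropy_prime_extension (R : realType) (G : groupType)
    (d : nat -> nat) (sigma : forall i, G -> {perm 'I_(d i)})
    (X Y : metricType R) (a : G -> X -> X) (b : G -> Y -> Y) (p : X -> Y) :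
  countable [set: G] -> infinite_set [set: G] -> sofic_approximation R sigma ->
  compact [set: X] -> continuous_action a ->
  topologically_prime_extension a b p ->
  (sofic_entropy a sigma <= sofic_entropy b sigma)%E.
Proof.
move=> cG iG sof cX ac prim.
have [dinf _ _] := sof; have [[cp _ pa] _] := prim.
rewrite leNgt; apply/negP => /ereal_real_between[LY [bLY]].
move=> /ereal_real_between[L []]; rewrite lte_fin => LYL La.
have [eps [idx [N [Phi [[eps0 idxk] Phi_Map Phi_sep N_large]]]]] :=
  sofic_entropy_gt_sequence cG dinf La.
have Dl n : exists K, forall k, (K <= k)%N -> (n <= d (idx k))%N.
  have [K _ HK] := dinf _ (nbhs_infty_ge n).
  by exists K => k Kk; apply: HK; exact: leq_trans (idxk k).
have Phi_coded e : 0 < e -> exists K, forall k, (K <= k)%N ->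
    coded [set: 'I_(N k)]%SET (expR (LY * (d (idx k))%:R))
    (fun j j' => forall v, mdist (p (Phi k j v)) (p (Phi k j' v)) < e).
  move=> e0; have e2 : 0 < e / 2 by rewrite divr_gt0.
  have [F [delta [i0 [fF delta0 H]]]] := Map_coded dinf bLY e2.
  have [delta' delta'0 pMap] := Map_comp F cX cp pa delta0.
  have [K HK] := Phi_Map F delta' fF delta'0.
  exists (maxn i0 K) => k; rewrite geq_max => /andP[i0k Kk].
  have := H _ (leq_trans i0k (idxk k)) _ (fun j => p \o Phi k j)
    (fun j => pMap _ _ _ (HK k Kk j)).
  apply: coded_sub => // j j' _ _ jj' v.
  by apply: (lt_le_trans (jj' v)); rewrite mulrC divfK.
have sep h x1 x2 := @prime_extension_separates R G X Y a b p h x1 x2 cX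
  (@metric_hausdorff _ Y) ac prim.
have [fD|iD] := pselect (finite_set [set x | exists2 x', x' <> x & p x' = p x]).
  apply: (finite_noninjective_absurd cX ac cp pa eps0 LYL Dl Phi_Map Phi_sep N_large
    Phi_coded iG _ fD) => g h gh m.
  have [K HK] := sofic_approximation_free sof gh m.
  by exists K => k Kk; apply: HK; exact: leq_trans (idxk k).
exact: (infinite_noninjective_absurd cX ac cp eps0 LYL Dl Phi_Map Phi_sep N_large
  Phi_coded cG sep iD).
Qed.

(** Positive entropy would give a separated family with more than one member. *)
Lemma sofic_entropy_subsingleton (R : realType) (G : groupType) (d : nat -> nat)
    (sigma : forall i, G -> {perm 'I_(d i)}) (X : metricType R) (a : G -> X -> X) :
  d @ \oo --> \oo -> (forall x y : X, x = y) -> (sofic_entropy a sigma <= 0)%E.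
Proof.
move=> dinf X1; rewrite leNgt; apply/negP => /ereal_real_between[L []].
rewrite lte_fin => L0 La.
have [eps e0 H] := sofic_entropy_gt dinf La.
have [K _ HK] := dinf _ (nbhs_infty_gt 0).
have [i [Ki [n [Phi [_ sepP nL]]]]] := H set0 1 K (finite_set0 _) ltr01.
have : (1 < n)%N.
  rewrite -(ltr_nat R); apply: lt_le_trans nL.
  by rewrite -[ltLHS]expR0 ltr_expR mulr_gt0// ltr0n; exact: HK.
move=> n1; have := sepP (Ordinal (ltnW n1)) (Ordinal n1) isT.
rewrite leNgt; move/negP; apply; apply/max_dist_lt => // v.
by rewrite (X1 (Phi (Ordinal n1) v) (Phi (Ordinal (ltnW n1)) v)) mdistxx.
Qed.

(** A copy of the one-point type that remembers [R], so that a metric with values in [R] can be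
    attached to it. *)
Definition one_point (R : realType) : Type := unit.

Section one_point.
Variable R : realType.

HB.instance Definition _ := Choice.on (one_point R).

Let dist (x y : one_point R) : R := 0.
Let dist_xx x : dist x x = 0. Proof. by []. Qed.
Let dist_positivity x y : dist x y = 0 -> x = y. Proof. by case: x; case: y. Qed.
Let dist_sym x y : dist x y = dist y x. Proof. by []. Qed.
Let dist_triangle y x z : dist x z <= dist x y + dist y z.
Proof. by rewrite addr0. Qed.

HB.instance Definition _ := isMetric.Build R (one_point R)
  dist_xx dist_positivity dist_sym dist_triangle.

End one_point.

Theorem theorem5p5 (R : realType) (G : groupType)
    (d : nat -> nat) (sigma : forall i, G -> {perm 'I_(d i)}) :
  countable [set: G] -> infinite_set [set: G] ->
  sofic_approximation R sigma ->
  (forall (X Y : metricType R) (a : G -> X -> X) (b : G -> Y -> Y) (p : X -> Y),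
     compact [set: X] -> compact [set: Y] ->
     continuous_action a -> continuous_action b ->
     topologically_prime_extension a b p ->
     (sofic_entropy a sigma <= sofic_entropy b sigma)%E)
  /\
  (forall (X : metricType R) (a : G -> X -> X),
     compact [set: X] -> continuous_action a ->
     topologically_prime a ->
     (sofic_entropy a sigma <= 0)%E).
Proof.
move=> cG iG sof; split=> [X Y a b p cX _ ac _|X a cX ac prim].
  exact: sofic_entropy_prime_extension.
have [dinf _ _] := sof.
(* An empty [X] does not map onto the point and is treated directly. *)
have [[x0 _]|X0] := pselect (exists x0 : X, True); last first.
  by apply: sofic_entropy_subsingleton => // x; case: X0; exists x.
pose b (g : G) (y : one_point R) := y.
pose p (x : X) : one_point R := tt.
apply: (@le_trans _ _ (sofic_entropy b sigma)); last first.
  by apply: sofic_entropy_subsingleton => // -[] [].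
apply: (@sofic_entropy_prime_extension _ _ _ _ _ _ a b p) => //.
split=> [|Z c f g cZ hZ cc fmf fmg gf].
  by split=> //; [move=> x; exact: cvg_cst | case; exists x0].
(* Primeness makes an intermediate factor either [X] itself or a point, and in the latter case [g]
   is the isomorphism. *)
have [|[z0 Zz0]] := prim Z c f cZ hZ cc fmf; first by left.
right; split=> //; exists (fun=> z0); split.
- by move=> z; rewrite (Zz0 z).
- by case; case: (g z0).
- exact: cst_continuous.
Qed.
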